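(* Let $2\le q\le p<\infty$ and $s\in\mathbb{N}$. For $i=1,\dots,s$ let $\Omega_i$ be a compact set (in some Euclidean space) with a probability measure $\mu_i$, and let $X(N_i,i)\subset\mathcal{C}(\Omega_i)$ be a subspace with $\dim X(N_i,i)=N_i$ such that $$\|f\|_\infty\le B_iN_i^{1/q}\|f\|_q\quad\text{for all } f\in X(N_i,i),\quad i=1,\dots,s,$$ where $B_i\ge1$. Then for a large enough constant $C=C(p,q)$ (depending only on $p,q$) there exists a set $\xi(m)=\{\xi^j\}_{j=1}^m\subset\Omega:=\Omega_1\times\cdots\times\Omega_s$ of $$m\le C\left(\prod_{i=1}^sB_i^pN_i^{p/q}\right)\left(\log_2\Bigl(2\prod_{i=1}^s(B_iN_i)\Bigr)\right)^3$$ points such that $$\frac12\|f\|_p^p\le\frac1m\sum_{j=1}^m|f(\xi^j)|^p\le\frac32\|f\|_p^p\quad\text{for all } f\in\mathbf{X}_{\mathbf{N}}.$$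
   Context: $\mathbf{N}:=(N_1,\dots,N_s)$ and $\mathbf{X}_{\mathbf{N}}:=\operatorname{span}\{f_1(\mathbf{x}^1)\times\cdots\times f_s(\mathbf{x}^s):\ f_i\in X(N_i,i),\ i=1,\dots,s\}\subset\mathcal{C}(\Omega_1\times\cdots\times\Omega_s)$. On $\Omega$ one uses the product measure $\mu=\mu_1\times\cdots\times\mu_s$. For functions on $\Omega$ (resp. $\Omega_i$), $\|f\|_p$ is the $L_p$ norm with respect to $\mu$ (resp. $\mu_i$), and $\|f\|_\infty$ is the uniform norm. Repetitions among points are allowed. *)

(* Defs.v *)
From HB Require Import structures.
From mathcomp Require Import all_boot all_order all_algebra.
From mathcomp Require Import all_classical all_reals all_analysis.

Set Implicit Arguments.
Unset Strict Implicit.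
Unset Printing Implicit Defensive.

Import Order.TTheory GRing.Theory Num.Theory.
Import numFieldNormedType.Exports.

Local Open Scope classical_set_scope.
Local Open Scope ring_scope.

(* The library's measurable types are pointed: [pointed_set a] is the subspace
   [A] (with its subtype topology) equipped with the base point [a], which plays
   no other role. A set carrying a probability measure is nonempty, so requiring
   a base point is no restriction. *)
Definition pointed_set {T : topologicalType} {A : set T} (a : A) : Type := A.

HB.instance Definition _ {T : topologicalType} {A : set T} (a : A) :=
  Topological.copy (pointed_set a) (set_type A).
HB.instance Definition _ {T : topologicalType} {A : set T} (a : A) :=
  isPointed.Build (pointed_set a) a.

Definition borel_space {T : topologicalType} {A : set T} (a : A) :=
  g_sigma_algebraType (@open (pointed_set a)).

Section product_measure.
Context {I : finType} {disp : I -> measure_display}.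
Variable T : forall i, measurableType (disp i).

Definition cylinder_set : set (set (forall i, T i)) :=
  [set A | exists i (B : set (T i)), measurable B /\ A = [set x | B (x i)]].

(* On a finite product of second countable spaces with their Borel sets, this is
   the Borel sigma-algebra of the product topology. *)
Definition product_space := g_sigma_algebraType cylinder_set.

(* By the pi-lambda theorem this determines [mu] as the product of the [mu_ i]. *)
Definition is_product_measure {R : realType}
    (mu_ : forall i, probability (T i) R) (mu : probability product_space R) :=
  forall A : forall i, set (T i), (forall i, measurable (A i)) ->
    mu [set x | forall i, A i (x i)] = (\prod_i mu_ i (A i))%E.

End product_measure.

Section subspaces.
Context {R : realType} {V : lmodType R}.

Definition lin_indep (n : nat) (e : 'I_n -> V) :=
  forall c : 'I_n -> R, \sum_k c k *: e k = 0 -> forall k, c k = 0.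

Definition lin_span (A : set V) : set V :=
  [set v | exists n (c : 'I_n -> R) (a : 'I_n -> V),
     (forall k, A (a k)) /\ v = \sum_k c k *: a k].

Definition subspace_of_dim (X : set V) (n : nat) :=
  exists2 e : 'I_n -> V, lin_indep e & X = lin_span (range e).

End subspaces.

Definition uniform_norm {R : realType} {T : Type} (f : T -> R) : \bar R :=
  ereal_sup (range (fun x => `|f x|%:E)).

(* [(f_1 x ... x f_s)(x^1, ..., x^s) = f_1(x^1) ... f_s(x^s)] *)
Definition tensor_fun {R : realType} {I : finType} {T : I -> Type}
    (f : forall i, T i -> R) (x : forall i, T i) : R := \prod_i f i (x i).

Definition tensor_space {R : realType} {I : finType} {T : I -> Type}
    (X : forall i, set (T i -> R)) : set ((forall i, T i) -> R) :=
  lin_span [set tensor_fun f | f in [set f | forall i, X i (f i)]].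

Definition log2 {R : realType} (x : R) : R := ln x / ln 2.

(* Main.v *)
Require Import Defs.
From HB Require Import structures.
From mathcomp Require Import all_boot all_order all_algebra.
From mathcomp Require Import all_classical all_reals all_analysis.
From mathcomp Require Import measurable_realfun measurable_fun_approximation.
From mathcomp Require Import ring lra.

Set Implicit Arguments.
Unset Strict Implicit.
Unset Printing Implicit Defensive.

Import Order.TTheory GRing.Theory Num.Theory.
Import numFieldNormedType.Exports.

Local Open Scope classical_set_scope.
Local Open Scope ring_scope.

(** The tensor space inherits a Nikol'skii inequality: integrating out one
    coordinate after the other gives
      [|f x|^q <= H^q * int |f|^q]   with   [H = prod_i B_i N_i^(1/q)],
    and [H^p] is the main factor of the announced number of points. What remains
    concerns any space [X] of dimension [N] with this inequality.

    Finding [m] points on which finitely many given bounded functions have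
    almost the right mean is a matter of Bernstein's inequality and a union
    bound. The points are chosen greedily, each one keeping an exponential
    potential at most at its mean ([bernstein_selection]): a function is somewhere
    at most its mean.

    Applied to a net of the unit ball of the uniform norm, this gives [n]
    points, [n] polynomial in [N] and [H], that preserve the [L_p] and [L_q]
    norms of [X] ([crude_discretization]). So [X] may be regarded as a space of
    functions on [n] points, and only [ln n] will matter.

    On [n] points, uniform convexity of [L_q] yields coverings of the [L_q]
    unit ball of [X] by [exp(c (H/t)^q ln n)] balls of radius [t] in the uniform
    norm ([covering_tree]). Cut [|f|^p] into dyadic
    layers according to the size of [|f|] ([layer]). A layer at height [a] is
    bounded by [a^p], and it is enough to know [f] up to a small multiple of
    [a] there. Hence Bernstein's inequality asks at this height for about
    [a^p * (H/a)^q * ln n <= H^p * ln n] points, whatever the height is, because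
    [q <= p]. The number of layers is logarithmic, and giving each an equal share of
    the error costs the square of their number ([finite_discretization]). The
    three logarithms are those of the statement. *)

(** * Inequalities for powers and exponentials *)

Section power_inequalities.
Context {R : realType}.
Implicit Types (a b u v x y p q : R).

Lemma powR_bernoulli y p : 0 <= y -> 1 <= p -> 1 + p * (y - 1) <= y `^ p.
Proof.
move=> y0; rewrite le_eqVlt => /predU1P[<-|p1].
  by rewrite powRr1// mul1r; lra.
have p0 : 0 < p by lra.
have pn0 : p != 0 by rewrite gt_eqF.
have p10 : p - 1 != 0 by rewrite gt_eqF//; lra.
have := @conjugate_powR R y 1 p (p / (p - 1)) y0 ler01 p0.
have q0 : 0 < p / (p - 1) by rewrite divr_gt0//; lra.
have pq : p^-1 + (p / (p - 1))^-1 = 1.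
  by rewrite invf_div -{1}[p^-1]mul1r -mulrDl addrC subrK divff.
move=> /(_ q0 pq); rewrite mulr1 powR1 => /(ler_wpM2l (ltW p0)).
rewrite invf_div mulrDr mulrCA divff// mulr1 mul1r.
rewrite [p * ((p - 1) / p)]mulrCA divff// mulr1.
by rewrite mulrBr mulr1; lra.
Qed.

(** Bernoulli's inequality for [u^q] and the exponent [p / q]. Averaged, it
    compares the [L_p] and the [L_q] norm of a function on a probability space. *)
Lemma powR_compare u p q : 0 < q -> q <= p -> 0 <= u ->
  1 + p / q * (u `^ q - 1) <= u `^ p.
Proof.
move=> q0 qp u0.
have := @powR_bernoulli (u `^ q) (p / q) (powR_ge0 _ _).
rewrite ler_pdivlMr// mul1r => /(_ qp).
by rewrite -powRrM mulrCA divff ?gt_eqF// mulr1.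
Qed.

Let powR_lipschitz_le u v b p : 1 <= p -> 0 <= v -> v <= u -> u <= b ->
  u `^ p - v `^ p <= p * b `^ (p - 1) * (u - v).
Proof.
move=> p1 v0 vu ub.
have [->|un0] := eqVneq u v.
  by rewrite !subrr mulr0.
have u0 : 0 < u.
  by apply: le_lt_trans v0 _; rewrite lt_neqAle eq_sym un0.
have := @powR_bernoulli (v / u) p (divr_ge0 v0 (ltW u0)) p1.
move=> /(ler_wpM2l (powR_ge0 u p)).
rewrite -powRM ?divr_ge0 ?(ltW u0)//.
have -> : u * (v / u) = v by field; rewrite gt_eqF.
move=> h.
apply: (@le_trans _ _ (p * u `^ (p - 1) * (u - v))); last first.
  rewrite ler_wpM2r ?subr_ge0// ler_wpM2l//; first by lra.
  by rewrite ge0_ler_powR// ?nnegrE; lra.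
have E : u `^ p * (1 + p * (v / u - 1)) = u `^ p - p * u `^ (p - 1) * (u - v).
  rewrite -(mulr_powRB1 (ltW u0) (lt_le_trans ltr01 p1)).
  by field; rewrite gt_eqF.
by move: h; rewrite E; lra.
Qed.

(** Bernoulli's inequality at the ratio of the two arguments stands in for the
    mean value theorem. *)
Lemma powR_lipschitz u v b p : 1 <= p -> 0 <= u <= b -> 0 <= v <= b ->
  `|u `^ p - v `^ p| <= p * b `^ (p - 1) * `|u - v|.
Proof.
move=> p1 /andP[u0 ub] /andP[v0 vb].
wlog vu : u v u0 ub v0 vb / v <= u.
  move=> H; have [|/ltW] := leP v u; first exact: H.
  by rewrite distrC [`|u - v|]distrC; exact: H.
rewrite !ger0_norm ?subr_ge0//; last by rewrite ge0_ler_powR// ?nnegrE//; lra.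
exact: powR_lipschitz_le.
Qed.

Lemma powR_lipschitz_norm a b p : 1 <= p -> `|a| <= 1 -> `|b| <= 1 ->
  `| `|a| `^ p - `|b| `^ p| <= p * `|a - b|.
Proof.
move=> p1 a1 b1.
have := @powR_lipschitz `|a| `|b| 1 p p1.
rewrite !normr_ge0 a1 b1 powR1 mulr1 => /(_ erefl erefl)/le_trans; apply.
by rewrite ler_wpM2l ?ler_dist_dist//; lra.
Qed.

(** Clarkson's inequality, pointwise. With [s] and [d] the half sum and the half
    difference, [|s|^q + |d|^q <= (s^2 + d^2)^(q/2)] because [q >= 2]; as
    [s^2 + d^2] is the mean of [a^2] and [b^2], convexity of the power [q/2]
    concludes, here through its tangent at that mean. *)
Lemma clarkson a b q : 2 <= q ->
  `|(a + b) / 2| `^ q + `|(a - b) / 2| `^ q <= (`|a| `^ q + `|b| `^ q) / 2.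
Proof.
move=> q2.
have sq x : `|x| `^ q = (x ^+ 2) `^ (q / 2).
  rewrite -[x ^+ 2]real_normK ?num_real// -powR_mulrn// -powRrM.
  by congr (_ `^ _); field.
rewrite !sq.
set u := ((a + b) / 2) ^+ 2; set v := ((a - b) / 2) ^+ 2.
have u0 : 0 <= u by exact: sqr_ge0.
have v0 : 0 <= v by exact: sqr_ge0.
have E : u + v = (a ^+ 2 + b ^+ 2) / 2 by rewrite /u /v; field.
set r := q / 2.
have r1 : 1 <= r by rewrite /r; lra.
have sup x y : 0 <= x -> 0 <= y -> x `^ r <= x * (x + y) `^ (r - 1).
  move=> x0 y0; rewrite -(mulr_powRB1 x0)//; last by lra.
  by rewrite ler_wpM2l// ge0_ler_powR// ?nnegrE; lra.
apply: (@le_trans _ _ ((u + v) `^ r)).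
  rewrite -(mulr_powRB1 (addr_ge0 u0 v0)); last by lra.
  rewrite mulrDl lerD ?sup//.
  by rewrite [u + v]addrC sup.
rewrite E.
have [E0|] := eqVneq ((a ^+ 2 + b ^+ 2) / 2) 0.
  rewrite E0 powR0 ?gt_eqF ?divr_ge0 ?addr_ge0 ?powR_ge0//; lra.
set w := (_ / 2) => w0.
have w1 : 0 < w.
  by rewrite lt_neqAle eq_sym w0 divr_ge0// addr_ge0// sqr_ge0.
have tangent x : 0 <= x -> w `^ r * (1 + r * (x / w - 1)) <= x `^ r.
  move=> x0.
  have := powR_bernoulli (divr_ge0 x0 (ltW w1)) r1.
  move=> /(ler_wpM2l (powR_ge0 w r)) /le_trans; apply.
  rewrite -powRM ?(ltW w1)//; last by rewrite divr_ge0 ?(ltW w1).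
  by rewrite [w * _]mulrCA divff// mulr1.
have := tangent _ (sqr_ge0 a); have := tangent _ (sqr_ge0 b).
have -> : w `^ r * (1 + r * (b ^+ 2 / w - 1)) =
  2 * w `^ r - w `^ r * (1 + r * (a ^+ 2 / w - 1)).
  have -> : b ^+ 2 = 2 * w - a ^+ 2 by rewrite /w; field.
  by field.
by lra.
Qed.

(** From [exp(-x) >= 1 - x], inverted. *)
Lemma expR_quadratic x : x <= 2^-1 -> expR x <= 1 + x + 2 * x ^+ 2.
Proof.
move=> x2; have := expR_ge1Dx (- x); rewrite expRN => h.
have x1 : 0 < 1 - x by lra.
have : expR x <= (1 - x)^-1.
  by rewrite -[leLHS]invrK lef_pV2 ?posrE// invr_gt0 expR_gt0.
move/le_trans; apply.
rewrite -[leLHS]mul1r ler_pdivrMr//.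
have : 0 <= x ^+ 2 * (1 - 2 * x) by rewrite mulr_ge0 ?sqr_ge0//; lra.
have -> : (1 + x + 2 * x ^+ 2) * (1 - x) = 1 + x ^+ 2 * (1 - 2 * x) by ring.
lra.
Qed.

Lemma powR_prod (I : finType) (a : I -> R) (r : R) : (forall i, 0 <= a i) ->
  (\prod_i a i) `^ r = \prod_i a i `^ r.
Proof.
move=> a0; suff [] : (\prod_i a i) `^ r = \prod_i a i `^ r /\ 0 <= \prod_i a i by [].
elim/big_rec2 : _ => [|i y1 y2 _ [<- y20]]; first by rewrite powR1.
by rewrite powRM// mulr_ge0.
Qed.

Lemma prod_ge1 (I : finType) (a : I -> R) :
  (forall i, 1 <= a i) -> 1 <= \prod_i a i.
Proof.
move=> a1; elim/big_ind : _ => // x y x1 y1.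
by rewrite -[leLHS]mulr1 ler_pM.
Qed.

End power_inequalities.

(** * Means and greedy selection of points *)

(** [averages D E]: on the class [D], [E] acts as a mean, in the only form in
    which means enter the proof: a finite linear combination of functions of
    [D] is somewhere at most its mean. Integrals against a probability measure
    and averages over finitely many points are both of this kind. *)
Definition averages {R : realType} {T : Type} (D : set (T -> R))
    (E : (T -> R) -> R) :=
  forall (I : finType) (c : I -> R) (f : I -> T -> R), (forall i, D (f i)) ->
    exists x, \sum_i c i * f i x <= \sum_i c i * E (f i).

Section averages.
Context {R : realType} {T : Type} (D : set (T -> R)) (E : (T -> R) -> R).
Hypothesis avgE : averages D E.

Lemma averages_le (f g : T -> R) (a b c : R) : D f -> D g ->
  (forall x, a * f x + c <= b * g x) -> a * E f + c <= b * E g.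
Proof.
move=> Df Dg fg.
have [|x] := @avgE bool (fun i => if i then b else - a)
  (fun i => if i then g else f); first by case.
by rewrite !big_bool /=; have := fg x; lra.
Qed.

Lemma averages_scale (f g : T -> R) (a : R) :
  D f -> D g -> (forall x, f x = a * g x) -> E f = a * E g.
Proof.
move=> Df Dg fg; apply/eqP; rewrite eq_le.
have := averages_le (a := 1) (b := a) (c := 0) Df Dg.
rewrite mul1r addr0 => ->; last by move=> x; rewrite mul1r addr0 fg.
have := averages_le (a := a) (b := 1) (c := 0) Dg Df.
by rewrite mul1r addr0 => -> // x; rewrite mul1r addr0 fg.
Qed.

(** Points are picked one at a time: since the weighted sum of the [u i] is
    somewhere at most its mean, some next point multiplies the potential
    [sum_i w_i * prod_j u_i(xi_j)] by no more than the mean would. *)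
Lemma greedy_selection (I : finType) (u : I -> T -> R) (c : I -> R) (m : nat)
    (w : I -> R) :
  (forall i x, 0 <= u i x) -> (forall i, 0 <= c i) ->
  (forall w : I -> R, (forall i, 0 <= w i) ->
     exists x, \sum_i w i * u i x <= \sum_i w i * c i) ->
  (forall i, 0 <= w i) ->
  exists xi : 'I_m -> T,
    \sum_i w i * \prod_j u i (xi j) <= \sum_i w i * c i ^+ m.
Proof.
move=> u0 c0 uc; elim: m w => [|m IH] w w0.
  have xi : 'I_0 -> T by case.
  exists xi; apply: ler_sum => i _; rewrite big_ord0 expr0//.
have [|xi hxi] := IH (fun i => w i * c i); first by move=> i; rewrite mulr_ge0.
have [|x hx] := uc (fun i => w i * \prod_j u i (xi j)).
  by move=> i; rewrite mulr_ge0// prodr_ge0.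
exists (fun j => if unlift ord0 j is Some k then xi k else x).
apply: (@le_trans _ _ (\sum_i w i * \prod_j u i (xi j) * u i x)).
  rewrite le_eqVlt; apply/orP; left; apply/eqP/eq_bigr => i _.
  rewrite big_ord_recl unlift_none -mulrA [_ * u i x]mulrC; congr (_ * (_ * _)).
  by apply: eq_bigr => j _; rewrite liftK.
apply: (le_trans hx).
rewrite (eq_bigr (fun i => w i * c i * \prod_j u i (xi j))); last first.
  by move=> i _; rewrite mulrAC.
apply: (le_trans hxi).
by under eq_bigr do rewrite -mulrA -exprS.
Qed.

(** Bernstein's inequality with a union bound, in the form of an existence
    statement: the potential is the sum over [i] of the exponential moments of
    both signs of the deviation of [g i]. The variance of [g i] is at most
    [b i] because its mean is at most 1. *)
Lemma bernstein_selection (I : finType) (g : I -> T -> R) (b : I -> R) (e : R)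
    (m : nat) :
  (forall i, D (g i)) -> (forall i, D (fun x => g i x ^+ 2)) ->
  (forall i, 0 < b i) -> (forall i x, 0 <= g i x <= b i) ->
  (forall i, E (g i) <= 1) ->
  0 < e <= 1 ->
  \sum_i 2 * expR (- (m%:R * e ^+ 2 / (8 * b i))) < 1 ->
  exists xi : 'I_m -> T, forall i,
    `|\sum_j g i (xi j) - m%:R * E (g i)| <= m%:R * e.
Proof.
move=> Dg Dg2 b0 gb Eg1 /andP[e0 e1] small.
have Eg0 i : 0 <= E (g i).
  have := @averages_le (g i) (g i) 0 1 0 (Dg i) (Dg i).
  by rewrite mul0r !mul1r addr0; apply => x; rewrite mul0r mul1r addr0; case/andP: (gb i x).
have Egb i : E (g i) <= b i.
  have := @averages_le (g i) (g i) 1 0 (- b i) (Dg i) (Dg i).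
  rewrite mul1r mul0r subr_le0; apply => x; rewrite mul1r mul0r subr_le0.
  by case/andP: (gb i x).
have Eg2 i : E (fun x => g i x ^+ 2) <= b i.
  have := @averages_le (fun x => g i x ^+ 2) (g i) 1 (b i) 0 (Dg2 i) (Dg i).
  rewrite mul1r addr0 => h; apply: (@le_trans _ _ (b i * E (g i))).
    apply: h => x; rewrite mul1r addr0 expr2 ler_wpM2r//; by case/andP: (gb i x).
  by rewrite ler_piMr// ltW.
(* the exponent [lam] minimizes, among those with [lam * b <= 1/2], the bound
   [exp(m * (2 * lam^2 * b - lam * e))] on the potential of [g i] *)
pose lam i := e / (4 * b i).
have lam0 i : 0 < lam i by rewrite divr_gt0// mulr_gt0.
have lamb i : lam i * b i = e / 4 by rewrite /lam; field; rewrite gt_eqF.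
(* the sign [s] selects the upper or the lower deviation *)
pose sg (s : bool) : R := if s then 1 else -1.
pose u (k : I * bool) x := expR (sg k.2 * lam k.1 * (g k.1 x - E (g k.1))).
pose c (k : I * bool) := expR (2 * lam k.1 ^+ 2 * b k.1).
pose w (k : I * bool) := expR (- (lam k.1 * e * m%:R)).
have sg2 s : sg s ^+ 2 = 1 by case: s; rewrite /sg ?sqrrN expr1n.
have uq k x : u k x <= 1 + sg k.2 * lam k.1 * (g k.1 x - E (g k.1)) +
    2 * lam k.1 ^+ 2 * (g k.1 x ^+ 2 - 2 * E (g k.1) * g k.1 x + E (g k.1) ^+ 2).
  rewrite /u; have /expR_quadratic/le_trans : sg k.2 * lam k.1 * (g k.1 x - E (g k.1)) <= 2^-1.
    rewrite -mulrA; apply: (@le_trans _ _ (lam k.1 * b k.1)).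
      apply: (le_trans (ler_norm _)); rewrite normrM.
      have -> : `|sg k.2| = 1 by rewrite /sg; case: k.2; rewrite ?normrN normr1.
      rewrite mul1r normrM (gtr0_norm (lam0 _)) ler_wpM2l ?(ltW (lam0 _))//.
      have := gb k.1 x; have := Eg0 k.1; have := Egb k.1; rewrite ler_norml; lra.
    by rewrite lamb; lra.
  apply; rewrite exprMn exprMn sg2 mul1r lerD2l.
  by rewrite le_eqVlt; apply/orP; left; apply/eqP; ring.
have [||w' w'0|k|xi hxi] := @greedy_selection _ u c m w.
- by move=> k x; exact: expR_ge0.
- by move=> k; exact: expR_ge0.
- pose a1 k := w' k * (sg k.2 * lam k.1 - 4 * lam k.1 ^+ 2 * E (g k.1)).
  pose a2 k := w' k * (2 * lam k.1 ^+ 2).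
  pose a0 k := w' k * (1 - sg k.2 * lam k.1 * E (g k.1) + 2 * lam k.1 ^+ 2 * E (g k.1) ^+ 2).
  have [|x hx] := @avgE ((I * bool) * bool)%type
      (fun k => if k.2 then a1 k.1 else a2 k.1)
      (fun k x => if k.2 then g k.1.1 x else g k.1.1 x ^+ 2).
    by move=> [k []] /=.
  have split2 (F : (I * bool) * bool -> R) :
      \sum_k F k = \sum_k (F (k, true) + F (k, false)).
    rewrite [RHS](eq_bigr (fun k => \sum_s F (k, s))); last first.
      by move=> k _; rewrite big_bool.
    by rewrite pair_bigA; apply: eq_bigr => -[].
  rewrite !split2 /= in hx.
  exists x; apply: (@le_trans _ _
      (\sum_k (a1 k * g k.1 x + a2 k * g k.1 x ^+ 2) + \sum_k a0 k)).
    rewrite -big_split; apply: ler_sum => k _ /=.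
    apply: (le_trans (ler_wpM2l (w'0 k) (uq k x))).
    by rewrite le_eqVlt; apply/orP; left; apply/eqP; rewrite /a0 /a1 /a2; ring.
  apply: (le_trans (lerD hx (lexx _))).
  rewrite -big_split; apply: ler_sum => k _ /=.
  apply: (@le_trans _ _ (w' k * (1 + 2 * lam k.1 ^+ 2 * b k.1))); last first.
    by rewrite ler_wpM2l// expR_ge1Dx.
  have -> : a1 k * E (g k.1) + a2 k * E (fun x => g k.1 x ^+ 2) + a0 k =
    w' k * (1 + 2 * lam k.1 ^+ 2 * (E (fun x => g k.1 x ^+ 2) - E (g k.1) ^+ 2)).
    by rewrite /a0 /a1 /a2; ring.
  rewrite ler_wpM2l// lerD2l ler_wpM2l//; first by rewrite mulr_ge0// sqr_ge0.
  by rewrite lerBlDr (le_trans (Eg2 _))// lerDl sqr_ge0.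
- exact: expR_ge0.
exists xi => i.
have tot : \sum_k w k * c k ^+ m < 1.
  suff -> : \sum_k w k * c k ^+ m = \sum_i 2 * expR (- (m%:R * e ^+ 2 / (8 * b i))) by [].
  under [RHS]eq_bigr do rewrite mulrDl mul1r.
  rewrite -(pair_bigA _ (fun i s => w (i, s) * c (i, s) ^+ m)) /=.
  apply: eq_bigr => k _; rewrite big_bool /w /c /=.
  rewrite -expRM_natl -expRD; congr (_ + _); congr expR;
    by rewrite /lam; field; rewrite gt_eqF.
have one s : sg s * (\sum_j g i (xi j) - m%:R * E (g i)) <= m%:R * e.
  have : w (i, s) * \prod_j u (i, s) (xi j) < 1.
    apply: le_lt_trans (le_lt_trans hxi tot).
    rewrite (bigD1 (i, s))//= lerDl sumr_ge0// => k _.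
    by rewrite mulr_ge0 ?expR_ge0// prodr_ge0// => j _; exact: expR_ge0.
  rewrite /w /u -expR_sum -expRD expR_lt1 /= -mulr_sumr sumrB sumr_const card_ord.
  rewrite -mulr_natl => h; apply/ltW; rewrite -(ltr_pM2l (lam0 i)); lra.
rewrite ler_norml; have := one true; have := one false; rewrite /sg; lra.
Qed.

End averages.

(** * Averages over finitely many points and entropy of unit balls *)

Definition linear_class {R : realType} {T : Type} (X : set (T -> R)) :=
  forall (a b : R) (f g : T -> R), X f -> X g ->
    X (fun x => a * f x + b * g x).

Definition mean {R : realType} {T : finType} (f : T -> R) : R :=
  #|T|%:R^-1 * \sum_x f x.

Section finite_mean.
Context {R : realType} {T : finType}.
Hypothesis T0 : (0 < #|T|)%N.
Implicit Types f g : T -> R.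

Let n0 : 0 < #|T|%:R :> R.
Proof. by rewrite ltr0n. Qed.

Lemma mean_cst (c : R) : mean (fun _ : T => c) = c.
Proof.
by rewrite /mean sumr_const -[c *+ _]mulr_natl mulKf// gt_eqF.
Qed.

Lemma meanD f g : mean (fun x => f x + g x) = mean f + mean g.
Proof. by rewrite /mean big_split mulrDr. Qed.

Lemma meanZ (c : R) f : mean (fun x => c * f x) = c * mean f.
Proof. by rewrite /mean -mulr_sumr mulrCA. Qed.

Lemma mean_sum (I : finType) (F : I -> T -> R) :
  mean (fun x => \sum_i F i x) = \sum_i mean (F i).
Proof. by rewrite /mean exchange_big mulr_sumr. Qed.

Lemma le_mean f g : (forall x, f x <= g x) -> mean f <= mean g.
Proof.
by move=> fg; rewrite /mean ler_wpM2l ?invr_ge0 ?(ltW n0)// ler_sum.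
Qed.

Lemma mean_ge0 f : (forall x, 0 <= f x) -> 0 <= mean f.
Proof. by move=> f0; rewrite -(mean_cst 0); exact: le_mean. Qed.

Lemma averages_mean : averages setT (@mean R T).
Proof.
move=> I c f _; apply: contrapT => /forallNP h.
have {}h x : \sum_i c i * mean (f i) < \sum_i c i * f i x.
  by rewrite ltNge; apply/negP; exact: h.
have : \sum_(x : T) \sum_i c i * mean (f i) < \sum_(x : T) \sum_i c i * f i x.
  apply: ltr_sum => //; move: T0 => /card_gt0P[x _].
  by apply/hasP; exists x => //; rewrite mem_index_enum.
rewrite sumr_const exchange_big /= -mulr_natl mulr_sumr.
rewrite lt_neqAle => /andP[/eqP + _]; apply; apply: eq_bigr => i _.
by rewrite /mean -mulr_sumr; field; rewrite gt_eqF.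
Qed.

End finite_mean.

Section covering.
Context {R : realType} {T : finType}.
Hypothesis T0 : (0 < #|T|)%N.
Variables (q H : R) (X : set (T -> R)).
Hypotheses (q2 : 2 <= q) (H0 : 0 < H) (linX : linear_class X).
Hypothesis nikX : forall f x, X f -> `|f x| `^ q <= H `^ q * mean (fun y => `|f y| `^ q).

Lemma mean_clarkson (f g : T -> R) :
  mean (fun x => `|(f x + g x) / 2| `^ q) + mean (fun x => `|(f x - g x) / 2| `^ q) <=
  (mean (fun x => `|f x| `^ q) + mean (fun x => `|g x| `^ q)) / 2.
Proof.
rewrite -!meanD [leRHS]mulrC -meanZ; apply: le_mean => // x.
by rewrite [leRHS]mulrC; exact: clarkson.
Qed.

(** A bound for the entropy in the uniform norm of the [L_q] unit ball of [X]
    that rests on uniform convexity only. Take [h] of nearly minimal [L_q] norm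
    in a midpoint-convex set [P]. A member [f] of [P] is within [t] of [h], or
    lies in one of the [2 #|T|] subsets of [P] cut out by a point [x], a sign and
    the condition that [f] is beyond [h] by [t] at [x]. On such a subset
    [(f - h) / 2] has a value of size [t / 2], so by the Nikol'skii inequality
    its norm to the power [q] is at least [(t / (2 * H))^q], and Clarkson's
    inequality shows that the minimum of the norm has grown by that much.
    Norms stay at most 1, so the tree of subsets has bounded depth [k]. *)
Lemma covering_tree (t : R) (k : nat) (P : set (T -> R)) : 0 < t ->
  P `<=` X ->
  (forall f g, P f -> P g -> P (fun x => (f x + g x) / 2)) ->
  (forall f, P f -> mean (fun x => `|f x| `^ q) <= 1) ->
  (forall f, P f ->
     1 < mean (fun x => `|f x| `^ q) + k%:R * (t / (2 * H)) `^ q) ->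
  exists s : seq (T -> R), (size s <= (2 * #|T|).+1 ^ k)%N /\
    forall f, P f -> exists2 g : T -> R, g \in s & forall x, `|f x - g x| <= t.
Proof.
move=> t0; set d := (t / _) `^ q.
have gap f h x : X f -> X h -> t <= `|f x - h x| ->
    d <= mean (fun x => `|(h x - f x) / 2| `^ q).
  move=> Xf Xh fhx; have Xd : X (fun x => (h x - f x) / 2).
    have -> : (fun x => (h x - f x) / 2) = (fun x => 2^-1 * h x + (- 2^-1) * f x).
      by apply/funext => y; field.
    exact: linX.
  have := nikX x Xd; rewrite [H `^ q * _]mulrC -ler_pdivrMr ?powR_gt0//; apply: le_trans.
  rewrite ler_pdivlMr ?powR_gt0// -powRM ?divr_ge0 ?mulr_ge0 ?(ltW t0) ?(ltW H0)//.
  have -> : t / (2 * H) * H = t / 2 by field; rewrite gt_eqF.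
  apply: ge0_ler_powR; rewrite ?nnegrE ?divr_ge0 ?(ltW t0) ?(le_trans _ q2)//.
  by rewrite normrM distrC [`|2^-1|]ger0_norm// ler_pM2r.
elim: k P => [|k IH] P PX Pmid P1 Pbig.
  exists [::]; split => // f Pf.
  by have := Pbig f Pf; rewrite mul0r addr0 ltNge P1.
(* without an [h] of nearly minimal norm the lower bound on the norms improves
   for free, and [P] itself satisfies the hypotheses at depth [k] *)
have [[h [Ph hk]]|noh] := pselect (exists h, P h /\
    mean (fun x => `|h x| `^ q) + k%:R * d <= 1); last first.
  have [|s [sk sP]] := IH P PX Pmid P1.
    by move=> f Pf; rewrite ltNge; apply/negP => fk; apply: noh; exists f.
  by exists s; split => //; apply: (leq_trans sk); rewrite leq_pexp2l.
pose sg (b : bool) : R := if b then 1 else -1.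
pose Q (z : T * bool) := [set f | P f /\ t <= sg z.2 * (f z.1 - h z.1)].
have QN z f : Q z f -> t <= `|f z.1 - h z.1|.
  move=> [_ /le_trans]; apply; rewrite /sg; case: z.2 => /=.
    by rewrite mul1r ler_norm.
  by rewrite mulN1r -normrN ler_norm.
have /choice[S hS] : forall z, exists s : seq (T -> R),
    (size s <= (2 * #|T|).+1 ^ k)%N /\
    forall f, Q z f -> exists2 g : T -> R, g \in s & forall x, `|f x - g x| <= t.
  move=> z; apply: IH => [f [/PX]//|f g [Pf fz] [Pg gz]|f [/P1]//|f Qf].
    split; first exact: Pmid.
    have -> : sg z.2 * ((f z.1 + g z.1) / 2 - h z.1) =
      (sg z.2 * (f z.1 - h z.1) + sg z.2 * (g z.1 - h z.1)) / 2 by field.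
    lra.
  have Pf := Qf.1.
  have := mean_clarkson h f; have := gap f h z.1 (PX _ Pf) (PX _ Ph) (QN _ _ Qf).
  have := Pbig _ (Pmid _ _ Ph Pf).
  rewrite -[k.+1%:R]natr1 mulrDl mul1r; lra.
exists (h :: flatten [seq S z | z <- enum {: T * bool}]); split.
  rewrite /= size_flatten /shape -map_comp sumnE big_map.
  rewrite expnS mulSn addnC -addn1 leq_add ?expn_gt0//.
  have E : (2 * #|T| = \sum_(z <- enum {: T * bool}) 1)%N.
    by rewrite sum1_size -cardE card_prod card_bool mulnC.
  rewrite [X in (_ <= X * _)%N]E big_distrl /=; apply: leq_sum => z _.
  rewrite mul1n; exact: (hS z).1.
move=> f Pf.
have [fh|] := pselect (forall x, `|f x - h x| <= t).
  by exists h; rewrite ?mem_head.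
move=> /existsNP[x /negP]; rewrite -ltNge => fx.
have [g gS fg] : exists2 g : T -> R, g \in S (x, 0 <= f x - h x) &
    forall y, `|f y - g y| <= t.
  apply: (hS (x, 0 <= f x - h x)).2; split => //=; apply: (le_trans (ltW fx)).
  rewrite /sg /=; case: (leP 0 (f x - h x)) => [?|?] /=; rewrite ?mul1r ?mulN1r.
    by rewrite ger0_norm.
  by rewrite ltr0_norm.
exists g => //; rewrite inE; apply/orP; right; apply/flattenP.
exists (S (x, 0 <= f x - h x)) => //.
by apply/mapP; exists (x, 0 <= f x - h x) => //; rewrite mem_enum.
Qed.

End covering.

(** Balls that meet the covered set are recentered at one of its points, so that
    the functions of the net inherit its norm bounds. *)
Lemma internal_net {R : realType} {T : Type} (S : set (T -> R)) (t : R)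
    (s : seq (T -> R)) :
  S !=set0 ->
  (forall f, S f -> exists2 g : T -> R, g \in s & forall x, `|f x - g x| <= t) ->
  exists g : 'I_(size s) -> T -> R, (forall i, S (g i)) /\
    forall f, S f -> exists i, forall x, `|f x - g i x| <= 2 * t.
Proof.
move=> [f0 Sf0] cov.
have /choice[c hc] : forall i : 'I_(size s), exists h, S h /\
    forall f, S f -> (forall x, `|f x - nth f0 s i x| <= t) ->
      forall x, `|f x - h x| <= 2 * t.
  move=> i; have [[h [Sh hi]]|no] := pselect (exists h, S h /\
      forall x, `|h x - nth f0 s i x| <= t).
    exists h; split => // f _ fi x.
    have := hi x; have := fi x; rewrite !ler_norml; lra.
  by exists f0; split => // f Sf fi; case: no; exists f.
exists c; split => [i|f Sf]; first by have [] := hc i.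
have [g gs fg] := cov f Sf.
have gi : (index g s < size s)%N by rewrite index_mem.
exists (Ordinal gi); apply: (hc (Ordinal gi)).2 => //= x.
by rewrite nth_index.
Qed.

(** * Dyadic layers of a power *)

Section layers.
Context {R : realType}.
Implicit Types (a h u v w p : R).

(** The part of [u^p] contributed by the range of sizes between [a / 2] and [a];
    these parts telescope along [a], [a / 2], [a / 4] and so on. *)
Definition layer p a u : R :=
  Num.min u a `^ p - Num.min u (a / 2) `^ p.

Let minP u a : 0 <= u -> 0 < a -> 0 <= Num.min u a.
Proof. by move=> u0 a0; rewrite le_min u0 ltW. Qed.

Lemma layer_ge0 p a u : 0 <= p -> 0 < a -> 0 <= u -> 0 <= layer p a u.
Proof.
move=> p0 a0 u0; rewrite /layer subr_ge0.
have a20 : 0 < a / 2 by rewrite divr_gt0.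
apply: ge0_ler_powR; rewrite ?nnegrE ?minP//.
by rewrite le_min ge_min lexx/= ge_min; apply/orP; right; lra.
Qed.

Lemma layer_le_cap p a u : 0 <= p -> 0 < a -> 0 <= u -> layer p a u <= a `^ p.
Proof.
move=> p0 a0 u0; rewrite /layer lerBlDr.
apply: (@le_trans _ _ (a `^ p)); last by rewrite lerDl powR_ge0.
by apply: ge0_ler_powR; rewrite ?nnegrE ?minP ?(ltW a0) ?ge_min ?lexx ?orbT.
Qed.

Lemma layer_le p a u : 0 <= p -> 0 < a -> 0 <= u -> layer p a u <= u `^ p.
Proof.
move=> p0 a0 u0; rewrite /layer lerBlDr.
apply: (@le_trans _ _ (u `^ p)); last by rewrite lerDl powR_ge0.
by apply: ge0_ler_powR; rewrite ?nnegrE ?minP ?(ltW a0) ?ge_min ?lexx ?orbT.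
Qed.

Lemma layer_small p a u : u <= a / 2 -> 0 < a -> layer p a u = 0.
Proof.
move=> ua a0; rewrite /layer !min_l ?subrr//; lra.
Qed.

Lemma min_lipschitz a u v : `|Num.min u a - Num.min v a| <= `|u - v|.
Proof.
by rewrite /Num.min; case: (ltP u a); case: (ltP v a) => h1 h2;
  rewrite ?lexx// ler_norml; have := ler_norm (u - v);
  have := ler_norm (v - u); rewrite (distrC v) => ? ?; apply/andP; split; lra.
Qed.

(** Near arguments far below the layer contribute nothing; otherwise the
    Lipschitz bound applies to both truncated powers. *)
Lemma layer_close p a h u v : 1 <= p -> 0 < a -> 0 <= h <= 4^-1 ->
  0 <= u -> 0 <= v -> `|u - v| <= h * a ->
  `|layer p a u - layer p a v| <= 2 * p * h * a `^ p * (a <= 4 * u)%R%:R.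
Proof.
move=> p1 a0 /andP[h0 h4] u0 v0 uv.
have ha : h * a <= a / 4 by rewrite mulrC ler_pM2l.
have [au|ua] := leP a (4 * u); last first.
  have /andP[v1 v2] : - (h * a) <= u - v <= h * a by rewrite -ler_norml.
  by rewrite mulr0 !layer_small ?subrr ?normr0//; lra.
rewrite mulr1.
have bnd b : 0 < b -> b <= a ->
    `|Num.min u b `^ p - Num.min v b `^ p| <= p * h * a `^ p.
  move=> b0 ba; apply: (@le_trans _ _ (p * a `^ (p - 1) * (h * a))).
    apply: (@le_trans _ _ (p * a `^ (p - 1) * `|Num.min u b - Num.min v b|)).
      by apply: powR_lipschitz => //; rewrite minP// ge_min ba orbT.
    rewrite ler_wpM2l ?mulr_ge0 ?powR_ge0 ?(le_trans _ p1)//.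
    exact: le_trans (min_lipschitz _ _ _) uv.
  rewrite -(mulr_powRB1 (ltW a0) (lt_le_trans ltr01 p1)).
  by rewrite le_eqVlt; apply/orP; left; apply/eqP; ring.
have a20 : 0 < a / 2 by rewrite divr_gt0.
have := bnd _ a0 (lexx _); have := bnd _ a20; rewrite /layer !ler_norml.
have a2 : a / 2 <= a by lra.
move=> /(_ a2); lra.
Qed.

Lemma sum_layer p a u J : 1 <= p -> 0 < a -> 0 <= u <= a ->
  \sum_(l < J) layer p (a / 2 ^+ l) u = u `^ p - Num.min u (a / 2 ^+ J) `^ p.
Proof.
move=> p1 a0 /andP[u0 ua]; elim: J => [|J IH].
  by rewrite big_ord0 expr0 divr1 min_l// subrr.
rewrite big_ord_recr IH /layer /= exprS invfM [2^-1 * _]mulrC mulrA.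
by rewrite addrA subrK.
Qed.

(** A geometric sum, whose first term is at most [a] and at most [w]. *)
Lemma sum_dyadic_below a w J : 0 < a -> 0 <= w ->
  \sum_(l < J) (a / 2 ^+ l <= w)%R%:R * (a / 2 ^+ l) <= 2 * Num.min a w.
Proof.
move=> a0 w0; elim: J a a0 => [|J IH] a a0.
  by rewrite big_ord0 mulr_ge0// le_min w0 ltW.
rewrite big_ord_recl expr0 divr1.
have a20 : 0 < a / 2 by rewrite divr_gt0.
rewrite (eq_bigr (fun l : 'I_J => ((a / 2) / 2 ^+ l <= w)%R%:R * ((a / 2) / 2 ^+ l))); last first.
  move=> l _; rewrite lift0.
  by have -> : a / 2 ^+ l.+1 = a / 2 / 2 ^+ l by rewrite exprS invfM mulrA.
have := IH _ a20; set s := \sum_(_ < _) _.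
by rewrite /Num.min; case: (leP a w) => aw; case: (ltP (a / 2) w) => aw2;
   case: ltP => ? ; rewrite /= ?mulr1n ?mulr0n ?mul1r ?mul0r; lra.
Qed.

Lemma sum_powR_dyadic_below p a w J : 1 <= p -> 0 < a -> 0 <= w ->
  \sum_(l < J) (a / 2 ^+ l <= w)%R%:R * (a / 2 ^+ l) `^ p <= 2 * w `^ p.
Proof.
move=> p1 a0 w0; apply: (@le_trans _ _
    (\sum_(l < J) w `^ (p - 1) * ((a / 2 ^+ l <= w)%R%:R * (a / 2 ^+ l)))).
  apply: ler_sum => l _; have al : 0 < a / 2 ^+ l by rewrite divr_gt0// exprn_gt0.
  case: (leP (a / 2 ^+ l) w) => aw /=; rewrite ?mulr0n ?mulr1n ?mul0r ?mulr0// !mul1r.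
  rewrite -(mulr_powRB1 (ltW al) (lt_le_trans ltr01 p1)) mulrC.
  rewrite ler_wpM2r ?(ltW al)//.
  by apply: ge0_ler_powR; rewrite ?nnegrE ?subr_ge0// ltW.
rewrite -mulr_sumr -(mulr_powRB1 w0 (lt_le_trans ltr01 p1)).
apply: (le_trans (ler_wpM2l (powR_ge0 _ _) (sum_dyadic_below J a0 w0))).
rewrite mulrCA ler_wpM2l// mulrC ler_wpM2r ?powR_ge0// ge_min lexx orbT //.
Qed.

(** The precision of [v l] is relative to the height of the layer, and only the
    layers below [4 u] contribute an error: a geometric sum bounds the total by a
    small multiple of [u^p]. *)
Lemma layer_approx p a h u (v : nat -> R) J : 1 <= p -> 0 < a ->
  0 <= h <= 4^-1 -> 0 <= u <= a ->
  (forall l, (l < J)%N -> 0 <= v l /\ `|u - v l| <= h * (a / 2 ^+ l)) ->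
  `|u `^ p - \sum_(l < J) layer p (a / 2 ^+ l) (v l)| <=
    4 * p * h * 4 `^ p * u `^ p + (a / 2 ^+ J) `^ p.
Proof.
move=> p1 a0 h04 u0a uv.
have al l : 0 < a / 2 ^+ l by rewrite divr_gt0// exprn_gt0.
have u0 : 0 <= u by case/andP: u0a.
have -> : u `^ p = \sum_(l < J) layer p (a / 2 ^+ l) u + Num.min u (a / 2 ^+ J) `^ p.
  by rewrite sum_layer// subrK.
rewrite addrAC -sumrB; apply: (le_trans (ler_normD _ _)); apply: lerD; last first.
  rewrite ger0_norm ?powR_ge0//.
  by apply: ge0_ler_powR; rewrite ?nnegrE ?minP ?(ltW (al _)) ?ge_min ?lexx ?orbT// (le_trans _ p1).
rewrite sum_layer// subrK.
apply: (le_trans (ler_norm_sum _ _ _)).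
apply: (@le_trans _ _ (\sum_(l < J) 2 * p * h *
    ((a / 2 ^+ l <= 4 * u)%R%:R * (a / 2 ^+ l) `^ p))).
  apply: ler_sum => l _; have [v0 uvl] := uv l (ltn_ord l).
  apply: (le_trans (layer_close p1 (al _) h04 u0 v0 uvl)).
  by rewrite le_eqVlt; apply/orP; left; apply/eqP; ring.
have ph : 0 <= 2 * p * h.
  by case/andP: h04 => h0 _; rewrite !mulr_ge0// (le_trans _ p1).
rewrite -mulr_sumr; apply: le_trans (ler_wpM2l ph (sum_powR_dyadic_below J p1 a0 _)) _.
  by rewrite mulr_ge0.
rewrite powRM//.
by rewrite le_eqVlt; apply/orP; left; apply/eqP; ring.
Qed.

Lemma mean_layers (T : finType) p a h (u : T -> R) (v : nat -> T -> R) J :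
  (0 < #|T|)%N -> 1 <= p -> 0 < a -> 0 <= h <= 4^-1 ->
  (forall x, 0 <= u x <= a) ->
  (forall l x, (l < J)%N -> 0 <= v l x /\ `|u x - v l x| <= h * (a / 2 ^+ l)) ->
  `|mean (fun x => u x `^ p) -
    \sum_(l < J) mean (fun x => layer p (a / 2 ^+ l) (v l x))| <=
    4 * p * h * 4 `^ p * mean (fun x => u x `^ p) + (a / 2 ^+ J) `^ p.
Proof.
move=> T0 p1 a0 h04 u0a uv.
have ptw x := @layer_approx p a h (u x) (v ^~ x) J p1 a0 h04 (u0a x)
  (fun l lJ => uv l x lJ).
rewrite -mean_sum -[(a / 2 ^+ J) `^ p](mean_cst T0) -meanZ -meanD.
rewrite -[- _]mulN1r -meanZ -meanD ler_norml -[- mean _]mulN1r -meanZ.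
by apply/andP; split; apply: le_mean => // x; have := ptw x; rewrite ler_norml;
   lra.
Qed.

End layers.

(** * Subsampling finitely many points *)

Section finite_discretization.
Context {R : realType}.
Variables (p q : R).
Hypotheses (q2 : 2 <= q) (qp : q <= p).

Let q0 : 0 < q. Proof. exact: lt_le_trans q2. Qed.
Let p0 : 0 < p. Proof. exact: lt_le_trans qp. Qed.
Let p1 : 1 <= p.
Proof. by apply: le_trans qp; apply: le_trans q2; rewrite ler1n. Qed.

Section nets.
Variables (T : finType) (H : R) (X : set (T -> R)).
Hypotheses (T0 : (0 < #|T|)%N) (H1 : 1 <= H) (linX : linear_class X).
Hypothesis nikX : forall f x, X f ->
  `|f x| `^ q <= H `^ q * mean (fun y => `|f y| `^ q).

Let H0 : 0 < H. Proof. exact: lt_le_trans H1. Qed.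

Definition unit_ball : set (T -> R) :=
  [set f | X f /\ mean (fun x => `|f x| `^ p) <= 1].

Lemma unit_ball_q f : unit_ball f -> mean (fun x => `|f x| `^ q) <= 1.
Proof.
move=> [_ fp]; have : mean (fun x => p / q * (`|f x| `^ q) + (1 - p / q)) <= 1.
  apply: le_trans fp; apply: le_mean => // x.
  by apply: le_trans (powR_compare q0 qp (normr_ge0 (f x))); lra.
rewrite (meanD (fun x => p / q * (`|f x| `^ q))) meanZ mean_cst//.
by rewrite -lerBrDr opprB addrCA subrr addr0 ger_pMr// divr_gt0.
Qed.

Lemma unit_ball_bounded f x : unit_ball f -> `|f x| <= H.
Proof.
move=> Sf; rewrite leNgt; apply/negP => Hf.
have := nikX x Sf.1; rewrite leNgt => /negP; apply.
apply: (@le_lt_trans _ _ (H `^ q)).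
  by rewrite ler_piMr ?powR_ge0// unit_ball_q.
by apply: gt0_ltr_powR => //; rewrite nnegrE// ltW.
Qed.

Lemma unit_ball_midpoint f g : unit_ball f -> unit_ball g ->
  unit_ball (fun x => (f x + g x) / 2).
Proof.
move=> [Xf f1] [Xg g1]; split.
  rewrite (_ : (fun _ => _) = (fun x => 2^-1 * f x + 2^-1 * g x)); last first.
    by apply/funext => x; field.
  exact: linX.
have := mean_clarkson T0 (le_trans q2 qp) f g.
have : 0 <= mean (fun x => `|(f x - g x) / 2| `^ p).
  by apply: mean_ge0 => // x; exact: powR_ge0.
lra.
Qed.

(** The number of centers comes from the depth [k] of the covering tree, the
    least integer exceeding [(4 H / (h a))^q]. *)
Lemma unit_ball_net (a h : R) : X (fun=> 0) -> 0 < h <= 1 -> 0 < a <= H ->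
  exists z : {M & 'I_M -> T -> R},
    [/\ forall i, unit_ball (tagged z i),
      forall f, unit_ball f -> exists i, forall x, `|f x - tagged z i x| <= h * a
    & (tag z)%:R <=
        expR (2 * (4 * H / (h * a)) `^ q * ln (2 * #|T|).+1%:R)].
Proof.
move=> X0 /andP[h0 h1] /andP[a0 aH].
pose t := h * a / 2; have t0 : 0 < t by rewrite divr_gt0// mulr_gt0.
set D := (4 * H / (h * a)) `^ q.
have D1 : 1 <= D.
  rewrite -[leLHS](powRr0 (4 * H / (h * a))) ler_powR ?(ltW q0)//.
  rewrite ler_pdivlMr ?mulr_gt0// mul1r.
  apply: (@le_trans _ _ (1 * H)); first by apply: ler_pM => //; exact: ltW.
  by rewrite ler_wpM2r ?ltW// ltr1n.
have dD : (t / (2 * H)) `^ q = D^-1.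
  have D0 : D != 0 by rewrite gt_eqF// (lt_le_trans _ D1).
  apply: (mulfI D0); rewrite divff// -powRM ?divr_ge0 ?mulr_ge0 ?ltW//.
  rewrite (_ : _ * _ = 1) ?powR1//.
  by rewrite /t; field; rewrite !gt_eqF.
pose k := (Num.truncn D).+1.
have kD : D < k%:R by rewrite /k truncnS_gt.
have kD2 : k%:R <= 2 * D.
  by rewrite /k -natr1 mulrDl mul1r; apply: lerD => //; rewrite truncn_le ?(le_trans _ D1).
have [||||s [sk sP]] := @covering_tree R T T0 q H X q2 H0 linX nikX t k unit_ball t0.
- by move=> f [].
- exact: unit_ball_midpoint.
- exact: unit_ball_q.
- move=> f Sf; rewrite dD -[ltLHS]add0r ler_ltD//.
    by apply: mean_ge0 => // x; exact: powR_ge0.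
  by rewrite ltr_pdivlMr ?mul1r// (lt_le_trans _ D1).
have [|g [Sg gP]] := internal_net _ sP.
  exists (fun=> 0); split => //.
  under [X in mean X]eq_fun do rewrite normr0 powR0 ?gt_eqF//.
  by rewrite mean_cst.
exists (existT _ (size s) g); split => //=.
  move=> f /gP[i fi]; exists i => x; apply: (le_trans (fi x)).
  by rewrite /t mulrC divfK.
have n1 : 1 <= (2 * #|T|).+1%:R :> R by rewrite ler1n.
apply: (@le_trans _ _ ((2 * #|T|).+1 ^ k)%:R); first by rewrite ler_nat.
rewrite natrX -[X in X ^+ k <= _](@lnK R) ?posrE ?(lt_le_trans _ n1)//.
by rewrite -expRM_natl ler_expR ler_wpM2r// ln_ge0.
Qed.

End nets.

(* the relative precision of the nets, for which [layer_approx] has error 1/40 *)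
Let h : R := (160 * p * 4 `^ p)^-1.

Let p4 : 1 <= 4 `^ p.
Proof. by rewrite -[leLHS](powRr0 4) ler_powR ?(ltW p0)// ler1n. Qed.

Let hE : 4 * p * h * 4 `^ p = 40^-1.
Proof.
by rewrite /h; field; rewrite !gt_eqF// (lt_le_trans _ p4).
Qed.

Let h0 : 0 < h.
Proof. by rewrite invr_gt0 !mulr_gt0// (lt_le_trans _ p4). Qed.

Let h4 : h <= 4^-1.
Proof.
rewrite /h lef_pV2 ?posrE ?mulr_gt0 ?(lt_le_trans _ p4)//.
rewrite -[leLHS]mulr1; apply: ler_pM => //.
by rewrite -[leLHS]mulr1; apply: ler_pM => //; rewrite ler_nat.
Qed.

Let K : R := (4 / h) `^ q.

Let K1 : 1 <= K.
Proof.
rewrite -[leLHS](powRr0 (4 / h)) ler_powR ?(ltW q0)// ler_pdivlMr// mul1r.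
by apply: (le_trans h4); rewrite (@le_trans _ _ 1)// ?ler1n// invf_le1// ler1n.
Qed.

(** The logarithm of the size of the net for the layer at height [a] grows like
    [(H / a)^q] as [a] decreases, but the functions of this layer are bounded by
    [a^p]: since [q <= p], the product of the two is controlled by [H^p] at every
    height. *)
Let entropy_cost H a : 0 < a -> a <= H ->
  a `^ p * (4 * H / (h * a)) `^ q <= K * H `^ p.
Proof.
move=> a0 aH; have H0 : 0 < H by exact: lt_le_trans aH.
have split b : 0 < b -> b `^ p = b `^ q * b `^ (p - q).
  by move=> b0; rewrite -powRD ?subrKC ?(gt_eqF b0) ?implybT.
rewrite (split a)// (split H)// mulrAC -powRM ?(ltW a0)//; last first.
  by rewrite divr_ge0 ?mulr_ge0 ?(ltW a0) ?(ltW h0) ?(ltW H0).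
have -> : a * (4 * H / (h * a)) = 4 / h * H by field; rewrite !gt_eqF.
rewrite powRM ?divr_ge0 ?(ltW h0) ?(ltW H0)// -/K -[K * H `^ q * _]mulrA.
rewrite ler_wpM2l ?powR_ge0//.
rewrite ler_wpM2l ?powR_ge0//.
by apply: ge0_ler_powR; rewrite ?nnegrE ?subr_ge0// ltW.
Qed.

(** Approximate [f] at each dyadic height [lam l] from a net of precision
    [h * lam l] and let the sampling respect the mean of the layer at height
    [lam l] of every function of that net, up to [e = 1 / (40 * J)]. The number of
    points that Bernstein's inequality asks for at height [lam l] is of order
    [J^2 * lam l ^ p] times the logarithm of the size of the net, which is of
    order [J^2 * H^p * (ln J + ln #|T|)] at every height. The approximation, the sampling
    and the truncation below the last layer cost 1/40 each, up to a factor. *)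
Lemma finite_discretization : exists2 C : R, 0 < C &
  forall (T : finType) (H : R) (X : set (T -> R)) (J m : nat),
  (0 < #|T|)%N -> 1 <= H -> linear_class X -> X (fun=> 0) ->
  (forall f x, X f -> `|f x| `^ q <= H `^ q * mean (fun y => `|f y| `^ q)) ->
  (0 < J)%N -> H / 2 ^+ J <= 40^-1 ->
  C * J%:R ^+ 2 * H `^ p * (ln (4 * J)%:R + ln (2 * #|T|).+1%:R) <= m%:R ->
  (0 < m)%N /\ exists xi : 'I_m -> T, forall f, X f ->
    `|mean (fun j => `|f (xi j)| `^ p) - mean (fun x => `|f x| `^ p)| <=
      5^-1 * mean (fun x => `|f x| `^ p).
Proof.
exists (16 * 40 ^+ 2 * K); first by rewrite !mulr_gt0 ?(lt_le_trans _ K1).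
move=> T H X J m T0 H1 linX X0 nikX J0 HJ hm.
have H0 : 0 < H by exact: lt_le_trans H1.
have J0' : 0 < J%:R :> R by rewrite ltr0n.
have K0 : 0 < K by exact: lt_le_trans K1.
have lnJ : 0 < ln (4 * J)%:R :> R by rewrite ln_gt0// ltr1n (@leq_mul 2 1).
have lnT : 0 <= ln (2 * #|T|).+1%:R :> R by rewrite ln_ge0// ler1n.
have m0 : 0 < m%:R :> R.
  have Hp : 0 < H `^ p by exact: powR_gt0.
  by apply: lt_le_trans hm; rewrite !mulr_gt0 ?exprn_gt0// ltr_wpDr.
have m0' : (0 < m)%N by rewrite -(ltr0n R).
split => //.
pose lam l : R := H / 2 ^+ l.
have lam0 l : 0 < lam l by rewrite divr_gt0// exprn_gt0.
have lamH l : lam l <= H.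
  by rewrite ler_pdivrMr ?exprn_gt0// ler_peMr ?(ltW H0)// exprn_ege1// ler1n.
have /choice[Z hZ] : forall l : 'I_J, exists z : {M & 'I_M -> T -> R},
    [/\ forall i, unit_ball X (tagged z i),
      forall f, unit_ball X f ->
        exists i, forall x, `|f x - tagged z i x| <= h * lam l
    & (tag z)%:R <= expR (2 * (4 * H / (h * lam l)) `^ q *
        ln (2 * #|T|).+1%:R)].
  move=> l; apply: unit_ball_net => //; last by rewrite lam0 lamH.
  by rewrite h0 (le_trans h4)// invf_le1// ler1n.
pose I := {l : 'I_J & 'I_(tag (Z l))}.
pose g (i : I) := fun x => layer p (lam (tag i)) `|tagged (Z (tag i)) (tagged i) x|.
pose b (i : I) := lam (tag i) `^ p.
pose e : R := (40 * J%:R)^-1.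
have Jn0 : J%:R != 0 :> R by rewrite gt_eqF.
have e0 : 0 < e by rewrite invr_gt0 mulr_gt0.
have [|||||||xi hxi] := @bernstein_selection R T setT (@mean R T)
    (averages_mean T0) I g b e m.
- by [].
- by [].
- by move=> i; exact: powR_gt0.
- move=> i x; rewrite /g layer_ge0 ?layer_le_cap ?normr_ge0//; exact: ltW.
- move=> i; have [/(_ (tagged i))[_ M1] _ _] := hZ (tag i).
  apply: le_trans M1; apply: le_mean => // x.
  by rewrite /g layer_le ?normr_ge0// ltW.
- rewrite e0 invf_le1 ?mulr_gt0//.
  by rewrite -[leLHS]mulr1; apply: ler_pM => //; rewrite ler1n.
- apply: (@le_lt_trans _ _ 2^-1); last by rewrite invf_lt1// ltr1n.
  pose F l (_ : 'I_(tag (Z l))) := 2 * expR (- (m%:R * e ^+ 2 / (8 * lam l `^ p))).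
  have -> : \sum_(i : I) 2 * expR (- (m%:R * e ^+ 2 / (8 * b i))) =
      \sum_(l < J) \sum_(j < tag (Z l)) F l j.
    by rewrite sig_big_dep.
  apply: (@le_trans _ _ (\sum_(l < J) (2 * J%:R)^-1)); last first.
    rewrite sumr_const card_ord -[_ *+ J]mulr_natl.
    by rewrite le_eqVlt; apply/orP; left; apply/eqP; field.
  apply: ler_sum => l _; rewrite /F sumr_const card_ord -[_ *+ tag _]mulr_natl.
  have [_ _ /(@ler_wpM2r _ (2 * expR (- (m%:R * e ^+ 2 / (8 * lam l `^ p)))))] := hZ l.
  move=> /(_ _)/le_trans; apply; first by rewrite mulr_ge0 ?expR_ge0.
  rewrite mulrCA -expRD.
  have -> : (2 * J%:R)^-1 = 2 * expR (- ln (4 * J)%:R) :> R.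
    rewrite expRN lnK ?posrE ?ltr0n ?muln_gt0// natrM.
    by field.
  rewrite ler_wpM2l// ler_expR.
  set D := (4 * H / _) `^ q; set L := ln _.+1%:R; set L4 := ln _%:R.
  suff : L4 + 2 * D * L <= m%:R * e ^+ 2 / (8 * lam l `^ p) by lra.
  rewrite ler_pdivlMr ?mulr_gt0 ?powR_gt0//.
  have -> : m%:R * e ^+ 2 = m%:R / (40 ^+ 2 * J%:R ^+ 2) by rewrite /e; field.
  rewrite ler_pdivlMr ?mulr_gt0 ?exprn_gt0//; apply: le_trans hm.
  have -> : (L4 + 2 * D * L) * (8 * lam l `^ p) * (40 ^+ 2 * J%:R ^+ 2) =
    16 * 40 ^+ 2 * J%:R ^+ 2 * (lam l `^ p * L4 / 2 + lam l `^ p * D * L) by field.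
  have -> : 16 * 40 ^+ 2 * K * J%:R ^+ 2 * H `^ p * (L4 + L) =
    16 * 40 ^+ 2 * J%:R ^+ 2 * (K * H `^ p * L4 + K * H `^ p * L) by ring.
  rewrite ler_wpM2l ?mulr_ge0 ?sqr_ge0// lerD//; last first.
    by rewrite ler_wpM2r ?entropy_cost.
  have y0 : 0 <= H `^ p * L4 by rewrite mulr_ge0 ?powR_ge0// ltW.
  have : lam l `^ p * L4 <= H `^ p * L4.
    rewrite ler_wpM2r ?(ltW lnJ)//.
    by apply: ge0_ler_powR; rewrite ?nnegrE ?(ltW p0)// ltW.
  have : H `^ p * L4 <= K * H `^ p * L4 by rewrite -mulrA ler_peMl.
  lra.
exists xi.
have norm1 f : X f -> mean (fun x => `|f x| `^ p) = 1 ->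
    `|mean (fun j => `|f (xi j)| `^ p) - 1| <= 5^-1.
  move=> Xf Mp1.
  have Sf : unit_ball X f by split; rewrite ?Mp1.
  have near (l : 'I_J) : exists i, forall x,
      `|f x - tagged (Z l) i x| <= h * lam l.
    by have [_ + _] := hZ l; exact.
  pose c l := projT1 (cid (near l)).
  have hc l x : `|f x - tagged (Z l) (c l) x| <= h * lam l.
    exact: (projT2 (cid (near l))).
  (* the layers are indexed by [nat]; beyond [J] the value is a default *)
  pose v l x := if insub l is Some l' then `|tagged (Z l') (c l') x| else 0.
  have vE (l : 'I_J) x : v l x = `|tagged (Z l) (c l) x| by rewrite /v valK.
  have fv l x : (l < J)%N -> 0 <= v l x /\ `| `|f x| - v l x| <= h * (H / 2 ^+ l).
    move=> lJ; rewrite -[l]/(val (Ordinal lJ)) vE; split => //.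
    exact: le_trans (ler_dist_dist _ _) (hc (Ordinal lJ) x).
  have fH x : 0 <= `|f x| <= H.
    by rewrite normr_ge0/=; exact: (@unit_ball_bounded T H X).
  have h04 : 0 <= h <= 4^-1 by rewrite h4 ltW.
  have lamJ : (H / 2 ^+ J) `^ p <= 40^-1.
    apply: (le_trans _ HJ); apply: ge1r_powR => //.
    by rewrite lam0 (le_trans HJ)// invf_le1// ler1n.
  have := mean_layers T0 p1 H0 h04 fH fv; rewrite hE Mp1.
  have m0c : (0 < #|'I_m|)%N by rewrite card_ord.
  have := mean_layers m0c p1 H0 h04 (fun j => fH (xi j)) (fun l j => fv l (xi j)).
  rewrite hE; set y := mean _; set A := \sum_(_ < _) _; set B := \sum_(_ < _) _.
  have AB : `|A - B| <= 40^-1.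
    rewrite /A /B -sumrB; apply: (le_trans (ler_norm_sum _ _ _)).
    apply: (@le_trans _ _ (\sum_(l < J) e)); last first.
      by rewrite sumr_const card_ord -[_ *+ J]mulr_natl /e invfM mulrCA divff// mulr1.
    apply: ler_sum => l _.
    have := hxi (existT _ l (c l)); rewrite /g /=.
    rewrite [mean in X in _ -> X]/mean card_ord.
    under eq_bigr do rewrite -vE.
    under [X in mean X]eq_fun do rewrite -vE.
    set P := \sum_(_ < m) _; set Q := mean _ => PQ.
    have -> : m%:R^-1 * P - Q = m%:R^-1 * (P - m%:R * Q).
      by rewrite mulrBr mulKf// gt_eqF.
    by rewrite normrM gtr0_norm ?invr_gt0// ler_pdivrMl.
  rewrite !ler_norml in AB *; lra.
move=> f Xf; set Mp := mean (fun x => `|f x| `^ p).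
have [M0|Mn0] := eqVneq Mp 0.
  have f0 x : f x = 0.
    have : \sum_x `|f x| `^ p = 0.
      move: M0; rewrite /Mp /mean => /eqP; rewrite mulf_eq0 invr_eq0 pnatr_eq0.
      by rewrite -leqn0 leqNgt T0 => /eqP.
    move=> /psumr_eq0P => /(_ (fun _ _ => powR_ge0 _ _) x isT).
    by move=> /powR_eq0_eq0/eqP; rewrite normr_eq0 => /eqP.
  rewrite M0 mulr0 subr0 (_ : (fun _ => _) = fun=> 0); last first.
    by apply/funext => j; rewrite f0 normr0 powR0// gt_eqF.
  by rewrite /mean big1// mulr0 normr0.
have Mp0 : 0 < Mp.
  by rewrite lt_neqAle eq_sym Mn0 mean_ge0// => x; exact: powR_ge0.
pose s := Mp `^ (- p^-1).
have sf x : `|s * f x| `^ p = Mp^-1 * `|f x| `^ p.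
  rewrite normrM powRM// ger0_norm ?powR_ge0// -powRrM mulNr mulVf ?gt_eqF//.
  by rewrite powR_inv1// ltW.
have Xsf : X (fun x => s * f x).
  have := linX s 0 f f Xf Xf; congr X; apply/funext => x.
  by rewrite mul0r addr0.
have := norm1 _ Xsf.
have -> : mean (fun x => `|s * f x| `^ p) = Mp^-1 * Mp.
  by rewrite -meanZ; congr mean; apply/funext => x; exact: sf.
have -> : mean (fun j => `|s * f (xi j)| `^ p) =
    Mp^-1 * mean (fun j => `|f (xi j)| `^ p).
  by rewrite -meanZ; congr mean; apply/funext => j; exact: sf.
rewrite mulVf// => /(_ erefl); rewrite -[1](mulVf Mn0) -mulrBr normrM.
by rewrite gtr0_norm ?invr_gt0// ler_pdivrMl// mulrC.
Qed.

End finite_discretization.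

(** * Nets of finite-dimensional spaces *)

Section finite_dimensional_nets.
Context {R : realType} {T : Type}.

Lemma bounded_combination n (c : 'I_n -> R) (e : 'I_n -> T -> R) :
  (forall k, exists b : R, forall x, `|e k x| <= b) ->
  exists b : R, forall x, `|\sum_k c k * e k x| <= b.
Proof.
move=> /choice[b hb]; exists (\sum_k `|c k| * b k) => x.
apply: (le_trans (ler_norm_sum _ _ _)).
by apply: ler_sum => k _; rewrite normrM ler_wpM2l.
Qed.

Lemma half_sup (f : T -> R) (b : R) :
  (forall x, `|f x| <= b) -> (exists x, f x != 0) ->
  exists2 x, f x != 0 & forall y, `|f y| <= 2 * `|f x|.
Proof.
move=> fb [x0 fx0].
pose S := [set `|f x| | x in setT].
have S0 : S `|f x0| by exists x0.
have hS : has_sup S by split; [exists `|f x0| | exists b => _ [x _ <-]].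
have s0 : 0 < sup S.
  by apply: (@lt_le_trans _ _ `|f x0|); rewrite ?normr_gt0// ub_le_sup//; case: hS.
have [_ [x _ <-] hx] := @sup_adherent _ S (sup S / 2) (divr_gt0 s0 (ltr0n _ 2)) hS.
exists x; first by rewrite -normr_gt0; lra.
move=> y; have : `|f y| <= sup S by apply: ub_le_sup; [case: hS|exists y].
lra.
Qed.

(** By induction on the number of functions. A function [f] of the span is split
    off at a point [x] where it nearly attains its maximum: [g - g x / f x * f]
    vanishes at [x], its norm is at most three times that of [g], and the
    functions of the span vanishing at [x] are spanned by one function fewer. *)
Lemma controlled_coordinates (n : nat) (e : 'I_n -> T -> R) :
  (forall k, exists b : R, forall x, `|e k x| <= b) ->
  exists l : 'I_n -> T -> R, (forall k x, `|l k x| <= 1) /\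
    forall (c : 'I_n -> R) (b : R), 0 <= b -> (forall x, `|\sum_k c k * e k x| <= b) ->
    exists a : 'I_n -> R, (forall k, `|a k| <= 4 ^+ n * b) /\
      forall x, \sum_k c k * e k x = \sum_k a k * l k x.
Proof.
elim: n e => [|n IH] e eb.
  exists (fun _ _ => 0); split=> [k x|c b _ _]; first by rewrite normr0.
  by exists (fun=> 0); split => [[]//|x]; rewrite !big_ord0.
have [[c0 [x1 hx1]]|no] := pselect (exists c x, \sum_k c k * e k x != 0);
  last first.
  exists (fun _ _ => 0); split=> [k x|c b b0 _]; first by rewrite normr0.
  have z x : \sum_k c k * e k x = 0.
    by apply: contrapT => /eqP h; apply: no; exists c, x.
  exists (fun=> 0); split => [k|x]; first by rewrite normr0 mulr_ge0// exprn_ge0.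
  by rewrite z big1// => k; rewrite mul0r.
pose f0 x := \sum_k c0 k * e k x.
have [b0 f0b] : exists b : R, forall x, `|f0 x| <= b.
  exact: bounded_combination.
have [x fx0 fmax] := half_sup f0b (ex_intro _ x1 hx1).
have [k ek0] : exists k, e k x != 0.
  apply: contrapT => /forallNP h; move: fx0; rewrite /f0 big1 ?eqxx// => k _.
  by have /negP := h k; rewrite negbK => /eqP ->; rewrite mulr0.
pose f y := f0 y / f0 x.
have f2 y : `|f y| <= 2.
  by rewrite /f normrM normfV ler_pdivrMr ?normr_gt0// fmax.
pose e' (j : 'I_n) y := e (lift k j) y - e (lift k j) x / e k x * e k y.
have [|l [l1 lP]] := IH e'.
  move=> j; have [b1 h1] := eb (lift k j); have [b2 h2] := eb k.
  exists (b1 + `|e (lift k j) x / e k x| * b2) => y.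
  apply: (le_trans (ler_normB _ _)); apply: lerD => //.
  by rewrite normrM ler_wpM2l.
exists (fun j => if unlift ord0 j is Some j' then l j' else (fun y => f y / 2)).
split.
  move=> j y; case: unliftP => [j' _|_]; first exact: l1.
  by rewrite normrM [`|2^-1|]ger0_norm// ler_pdivrMr ?mul1r.
move=> c b b00 cb.
pose g y := \sum_k c k * e k y.
pose d j := c j - g x / f0 x * c0 j.
have dE y : \sum_j d j * e j y = g y - g x * f y.
  rewrite /d; under eq_bigr do rewrite mulrBl -!mulrA.
  by rewrite sumrB -!mulr_sumr -/(f0 y) -/(g y) [_^-1 * _]mulrC.
have dx : \sum_j d j * e j x = 0 by rewrite dE /f divff// mulr1 subrr.
have d'E y : \sum_(j < n) d (lift k j) * e' j y = g y - g x * f y.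
  rewrite -dE [RHS](bigD1_ord k)//=.
  move: dx; rewrite (bigD1_ord k)//= => /eqP.
  rewrite addr_eq0 => /eqP dk.
  have -> : d k * e k y = - (\sum_(j < n) d (lift k j) * e (lift k j) x) / e k x * e k y.
    by rewrite -dk mulfK.
  rewrite /e'; under eq_bigr do rewrite mulrBr.
  rewrite sumrB addrC; congr (_ + _).
  rewrite !mulNr; congr (- _); rewrite !mulr_suml; apply: eq_bigr => j _.
  by rewrite !mulrA.
have [|a [ab aP]] := lP (fun j => d (lift k j)) (3 * b) (mulr_ge0 (ler0n _ 3) b00).
  move=> y; rewrite d'E; apply: (le_trans (ler_normB _ _)).
  rewrite normrM; have := ler_pM (normr_ge0 _) (normr_ge0 _) (cb x) (f2 y).
  have := cb y; rewrite -/(g y) -/(g x); lra.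
exists (fun j => if unlift ord0 j is Some j' then a j' else 2 * g x).
split.
  move=> j; case: unliftP => [j' _|_].
    apply: (le_trans (ab j')); rewrite exprS.
    have : 0 <= 4 ^+ n * b by rewrite mulr_ge0// exprn_ge0.
    lra.
  rewrite normrM [`|2|]ger0_norm// exprS -mulrA.
  have : b <= 4 ^+ n * b by rewrite ler_peMl// exprn_ege1// ler1n.
  have := cb x; rewrite -/(g x); lra.
move=> y; rewrite [RHS]big_ord_recl unlift_none -/(g y).
under [in RHS]eq_bigr do rewrite liftK.
by rewrite -aP d'E; field.
Qed.

(** Round the coordinates, at most [4^n] in absolute value, to multiples of
    [t / n]. *)
Lemma grid_net (n : nat) (e : 'I_n -> T -> R) (X : set (T -> R)) (t : R) :
  (0 < n)%N -> 0 < t -> X (fun=> 0) ->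
  (forall k, exists b : R, forall x, `|e k x| <= b) ->
  (forall f, X f -> exists c, forall x, f x = \sum_k c k * e k x) ->
  exists M (g : 'I_M -> T -> R), [/\
    M%:R <= (2 * 4 ^+ n * n%:R / t + 1) ^+ n,
    forall i, X (g i) /\ forall x, `|g i x| <= 1 &
    forall f, X f -> (forall x, `|f x| <= 1) ->
      exists i, forall x, `|f x - g i x| <= 2 * t].
Proof.
move=> n0 t0 X0 eb Xe; have [l [l1 lP]] := controlled_coordinates eb.
have n0' : 0 < n%:R :> R by rewrite ltr0n.
pose h := t / n%:R; have h0 : 0 < h by rewrite divr_gt0.
pose A : R := 4 ^+ n; have A0 : 0 <= A by rewrite exprn_ge0.
pose G := (Num.truncn (2 * A / h)).+1.
have Ah0 : 0 <= 2 * A / h.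
  by apply: divr_ge0; [exact: mulr_ge0|exact: ltW].
pose s := [seq (fun x => \sum_k ((phi k)%:R * h - A) * l k x) |
            phi : {ffun 'I_n -> 'I_G}].
pose S := [set f | X f /\ forall x, `|f x| <= 1].
have cov f : S f -> exists2 g : T -> R, g \in s & forall x, `|f x - g x| <= t.
  move=> [Xf f1]; have [c cE] := Xe f Xf.
  have [|a [aA aE]] := lP c 1 ler01; first by move=> x; rewrite -cE.
  have aA' k : - A <= a k <= A by rewrite -ler_norml -[A]mulr1.
  have ah0 k : 0 <= (a k + A) / h.
    by rewrite divr_ge0 ?(ltW h0)//; have := aA' k; lra.
  have ahG k : (Num.truncn ((a k + A) / h) < G)%N.
    rewrite ltnS le_truncn// ler_wpM2r ?invr_ge0 ?(ltW h0)//.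
    by have := aA' k; lra.
  exists (fun x => \sum_k ((Num.truncn ((a k + A) / h))%:R * h - A) * l k x).
    apply/mapP; exists [ffun k => Ordinal (ahG k)]; first by rewrite mem_enum.
    by apply/funext => x; apply: eq_bigr => k _; rewrite ffunE.
  move=> x; rewrite cE aE -sumrB; apply: (le_trans (ler_norm_sum _ _ _)).
  apply: (@le_trans _ _ (\sum_(k < n) h)); last first.
    by rewrite sumr_const card_ord -[h *+ n]mulr_natl /h mulrC divfK// gt_eqF.
  apply: ler_sum => k _; rewrite -mulrBl normrM -[leRHS]mulr1.
  apply: ler_pM => //; have /andP[] := truncn_itv (ah0 k).
  move: (Num.truncn _) => j; rewrite ler_pdivlMr// ltr_pdivrMr// => u1.
  by rewrite -natr1 [(_ + 1) * h]mulrDl mul1r => u2; rewrite ler_norml; lra.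
have [|g [Sg gP]] := internal_net _ cov.
  by exists (fun=> 0); split => // x; rewrite normr0.
exists (size s), g; split => [|//|f Xf f1]; last exact: gP.
rewrite size_image card_ffun !card_ord natrX lerXn2r ?nnegrE//.
  by rewrite addr_ge0 ?divr_ge0 ?mulr_ge0 ?exprn_ge0// ltW.
rewrite /G -[(Num.truncn _).+1%:R]natr1 lerD2r.
apply: (@le_trans _ _ (2 * A / h)); first by rewrite truncn_le.
by rewrite /h /A le_eqVlt; apply/orP; left; apply/eqP; field; rewrite !gt_eqF.
Qed.

End finite_dimensional_nets.

(** * A first sampling with polynomially many points *)

Section crude_discretization.
Context {R : realType}.
Variables (p q : R).
Hypotheses (q2 : 2 <= q) (qp : q <= p).

Let q0 : 0 < q. Proof. exact: lt_le_trans q2. Qed.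
Let p0 : 0 < p. Proof. exact: lt_le_trans qp. Qed.
Let p1 : 1 <= p.
Proof. by apply: le_trans qp; apply: le_trans q2; rewrite ler1n. Qed.

(* [W]: a lower bound for the means is [1 / W]; [eps]: the sampling error;
   [t]: the precision of the net, so that [r]-th powers move by [eps];
   [Gr ^+ n]: the size of the net *)
Let W H : R := (2 * H) `^ p.
Let c : R := 240 * p * 2 `^ p + 1.
Let eps H : R := (60 * W H)^-1.
Let t H : R := eps H / (2 * p).
Let Gr n H : R := 2 * 4 ^+ n * n%:R / t H + 1.

Let W1 H : 1 <= H -> 1 <= W H.
Proof. by move=> H1; rewrite -[leLHS](powRr0 (2 * H)) ler_powR ?(ltW p0)//; lra. Qed.

Let c1 : 1 <= c.
Proof. by rewrite lerDr !mulr_ge0 ?powR_ge0 ?(ltW p0). Qed.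

Let c10 : 0 <= 10 + c + p.
Proof. by have := c1; have := p0; lra. Qed.

Let net_size n H : (0 < n)%N -> 1 <= H ->
  1 <= Gr n H /\ ln (5 * Gr n H ^+ n) <= (10 + c + p) * n%:R ^+ 2 * H.
Proof.
move=> n0 H1; have H0 : 0 < H by exact: lt_le_trans H1.
have W0 : 0 < W H by apply: lt_le_trans (W1 H1).
have n1 : 1 <= n%:R :> R by rewrite ler1n.
have A1 : 1 <= 4 ^+ n :> R by rewrite exprn_ege1// ler1n.
have GE : Gr n H = 4 ^+ n * n%:R * (240 * p * W H) + 1.
  by rewrite /Gr /t /eps; field; rewrite !gt_eqF.
have X0 : 0 <= 240 * p * W H by rewrite !mulr_ge0 ?ltW.
have An : 1 <= 4 ^+ n * n%:R :> R by rewrite -[leLHS]mulr1 ler_pM.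
have G1 : 1 <= Gr n H by rewrite GE lerDr mulr_ge0// (le_trans _ An).
split => //.
have G0 : 0 < Gr n H by exact: lt_le_trans G1.
have Hp1 : 1 <= H `^ p by rewrite -[leLHS](powRr0 H) ler_powR ?(ltW p0).
have Gle : Gr n H <= 4 ^+ n * n%:R * (c * H `^ p).
  rewrite GE /W /c powRM ?(ltW H0)//.
  have -> : 4 ^+ n * n%:R * ((240 * p * 2 `^ p + 1) * H `^ p) =
    4 ^+ n * n%:R * (240 * p * (2 `^ p * H `^ p)) + 4 ^+ n * n%:R * H `^ p by ring.
  by rewrite lerD2l -[leLHS]mulr1 ler_pM.
have lnG : ln (Gr n H) <= 4 * n%:R + n%:R + c + p * H.
  have pos4 : 0 < 4 ^+ n :> R by exact: lt_le_trans A1.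
  have posn : 0 < n%:R :> R by exact: lt_le_trans n1.
  have posc : 0 < c by exact: lt_le_trans c1.
  have posH : 0 < H `^ p by exact: powR_gt0.
  apply: (@le_trans _ _ (ln (4 ^+ n * n%:R * (c * H `^ p)))).
    by rewrite ler_ln ?posrE ?mulr_gt0.
  rewrite !lnM ?posrE ?mulr_gt0// lnXn// ln_powR -addrA -addrA.
  rewrite -[ln 4 *+ n]mulr_natr.
  have l4 : ln 4 * n%:R <= 4 * n%:R :> R by rewrite ler_wpM2r ?ltW// ln_sublinear.
  have ln_n : ln n%:R <= n%:R :> R by rewrite ltW// ln_sublinear.
  have lc : ln c <= c by rewrite ltW// ln_sublinear.
  have lH : p * ln H <= p * H by rewrite ler_wpM2l ?(ltW p0)// ltW// ln_sublinear.
  lra.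
have G0n : 0 < Gr n H ^+ n by rewrite exprn_gt0.
rewrite lnM ?posrE// lnXn// -[_ *+ n]mulr_natr.
have l5 : ln 5 <= 5 :> R by rewrite ltW// ln_sublinear.
have nH : 1 <= n%:R * H by rewrite -[leLHS]mulr1 ler_pM.
have n0' : 0 <= n%:R :> R by [].
have e1 : ln (Gr n H) * n%:R <= (4 * n%:R + n%:R + c + p * H) * n%:R by rewrite ler_wpM2r.
have e2 : n%:R * n%:R <= n%:R ^+ 2 * H by rewrite expr2 ler_peMr// mulr_ge0.
have e3 : n%:R <= n%:R ^+ 2 * H by rewrite expr2 -mulrA ler_peMr.
have e4 : n%:R * H <= n%:R ^+ 2 * H by rewrite expr2 -mulrA ler_peMl// mulr_ge0// ltW.
have e5 : c * n%:R <= c * (n%:R ^+ 2 * H) by rewrite ler_wpM2l// (le_trans _ c1).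
have e6 : p * (n%:R * H) <= p * (n%:R ^+ 2 * H) by rewrite ler_wpM2l// ltW.
lra.
Qed.

(** Bernstein's inequality on a net of the functions of uniform norm at most 1
    asks for polynomially many points only. Indeed the mean of [|f|^r] is at
    least [(2 H)^(-p)] when [f] comes within a factor 2 of its bound 1, so an
    additive error of a small multiple of [(2 H)^(-p)] is a small relative
    error. *)
Lemma crude_discretization : exists2 C : R, 0 < C &
  forall (T : Type) (D : set (T -> R)) (E : (T -> R) -> R) (n : nat)
    (e : 'I_n -> T -> R) (X : set (T -> R)) (H : R),
  averages D E -> (0 < n)%N -> 1 <= H -> linear_class X -> X (fun=> 0) ->
  (forall k, exists b : R, forall x, `|e k x| <= b) ->
  (forall f, X f -> exists c, forall x, f x = \sum_k c k * e k x) ->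
  (forall f r, X f -> r = p \/ r = q ->
     D (fun x => `|f x| `^ r) /\ D (fun x => (`|f x| `^ r) ^+ 2)) ->
  (forall f x, X f -> `|f x| `^ q <= H `^ q * E (fun y => `|f y| `^ q)) ->
  exists m (xi : 'I_m -> T), [/\ (0 < m)%N,
    m%:R <= C * (n%:R ^+ 2 * H * (H `^ p) ^+ 2) &
    forall f r, X f -> r = p \/ r = q ->
      `|mean (fun j => `|f (xi j)| `^ r) - E (fun x => `|f x| `^ r)| <=
        20^-1 * E (fun x => `|f x| `^ r)].
Proof.
exists (8 * 60 ^+ 2 * (2 `^ p) ^+ 2 * (10 + c + p) + 1).
  by rewrite ltr_wpDl// mulr_ge0// !mulr_ge0 ?exprn_ge0 ?powR_ge0.
move=> T D E n e X H avgE n0 H1 linX X0 eb Xe DX nikX.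
have H0 : 0 < H by exact: lt_le_trans H1.
have W0 : 0 < W H by apply: lt_le_trans (W1 H1).
have [G1 Gln] := net_size n0 H1.
have eps0 : 0 < eps H by rewrite invr_gt0 mulr_gt0.
have t0 : 0 < t H by rewrite divr_gt0// mulr_gt0.
have [M [g [Mle gX gP]]] := grid_net n0 t0 X0 eb Xe.
pose L := (10 + c + p) * n%:R ^+ 2 * H.
have L0 : 0 <= L.
  by rewrite mulr_ge0 ?(ltW H0)// mulr_ge0 ?exprn_ge0.
pose m := (Num.truncn (8 * (60 * W H) ^+ 2 * L)).+1.
have mL : 8 * (60 * W H) ^+ 2 * L <= m%:R by rewrite ltW// /m truncnS_gt.
pose rr (s : bool) := if s then p else q.
have rr1 s : 1 <= rr s <= p.
  by case: s; rewrite /rr ?p1 ?lexx// qp (le_trans _ q2)// ler1n.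
have rr0 s : 0 < rr s by case/andP: (rr1 s) => /(lt_le_trans ltr01).
have rrpq s : rr s = p \/ rr s = q by case: s; [left|right].
have gr1 i s x : `|g i x| `^ rr s <= 1.
  rewrite -[leRHS](congr1 (@^~ (rr s)) (@powR1 R)).
  by apply: ge0_ler_powR; rewrite ?nnegrE ?(ltW (rr0 s))// (gX i).2.
have [|||||||xi hxi] := @bernstein_selection R T D E avgE ('I_M * bool)%type
    (fun z x => `|g z.1 x| `^ rr z.2) (fun=> 1) (eps H) m.
- by move=> [i s]; have [] := DX _ _ (gX i).1 (rrpq s).
- by move=> [i s]; have [] := DX _ _ (gX i).1 (rrpq s).
- by [].
- by move=> [i s] x /=; rewrite powR_ge0 gr1.
- move=> [i s] /=.
  have Dg := (DX _ _ (gX i).1 (rrpq s)).1.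
  have := averages_le avgE (a:=1) (b:=0) (c:=-1) Dg Dg.
  by rewrite mul1r mul0r subr_le0; apply => x; rewrite mul1r mul0r subr_le0 gr1.
- rewrite eps0 invf_le1 ?mulr_gt0// -[leLHS]mulr1 ler_pM ?ler1n// W1//.
- rewrite sumr_const card_prod card_ord card_bool -[_ *+ (M * 2)]mulr_natl natrM mulr1.
  apply: (@le_lt_trans _ _ (Gr n H ^+ n * 2 * (2 * (5 * Gr n H ^+ n)^-1))).
    have G0n : 0 < 5 * Gr n H ^+ n by rewrite mulr_gt0// exprn_gt0// (lt_le_trans _ G1).
    rewrite ler_pM ?mulr_ge0 ?expR_ge0//; first by rewrite ler_wpM2r.
    rewrite ler_wpM2l// -[leRHS]lnK ?posrE ?invr_gt0// ler_expR lnV ?posrE//.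
    rewrite lerN2; apply: (le_trans Gln); rewrite -/L.
    rewrite ler_pdivlMr// /eps exprVn mulrC ler_pdivlMr ?exprn_gt0 ?mulr_gt0//.
    by apply: le_trans mL; rewrite le_eqVlt; apply/orP; left; apply/eqP; ring.
  have G0n : Gr n H ^+ n != 0 by rewrite expf_neq0// gt_eqF// (lt_le_trans _ G1).
  move: (Gr n H ^+ n) G0n => y y0.
  have -> : y * 2 * (2 * (5 * y)^-1) = 4 / 5 by field.
  lra.
exists m, xi; split => //.
  rewrite /m -[(Num.truncn _).+1%:R]natr1 [leRHS]mulrDl mul1r lerD//.
    rewrite -[leRHS]mulr1 (@le_trans _ _ (8 * (60 * W H) ^+ 2 * L))//.
      by rewrite truncn_le !mulr_ge0 ?exprn_ge0 ?mulr_ge0// ltW.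
    rewrite /L /W powRM ?(ltW H0)//.
    by rewrite le_eqVlt; apply/orP; left; apply/eqP; ring.
  have n1 : 1 <= n%:R :> R by rewrite ler1n.
  have Hp1 : 1 <= H `^ p by rewrite -[leLHS](powRr0 H) ler_powR ?(ltW p0).
  rewrite -[leLHS]mulr1 ler_pM// ?exprn_ege1//.
  by rewrite -[leLHS]mulr1 ler_pM// exprn_ege1.
move=> f r Xf hr.
have {hr}[s ->] : exists s, r = rr s by case: hr => ->; [exists true|exists false].
have DXs h k : X h -> D (fun x => `|h x| `^ rr k).
  by move=> Xh; have [] := DX h (rr k) Xh (rrpq k).
have [f0|] := pselect (forall x, f x = 0).
  have z x : `|f x| `^ rr s = 0 by rewrite f0 normr0 powR0// gt_eqF.
  have -> : E (fun x => `|f x| `^ rr s) = 0.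
    have := averages_scale avgE (DXs f s Xf) (DXs f s Xf) (a := 0).
    by rewrite mul0r; apply=> x; rewrite mul0r z.
  by rewrite mulr0 subr0 /mean big1 ?mulr0 ?normr0// => j _; rewrite z.
move=> /existsNP[x1 /eqP fx1].
have [b fb] : exists b : R, forall x, `|f x| <= b.
  have [c' cE] := Xe f Xf; have [b hb] := bounded_combination c' eb.
  by exists b => x; rewrite cE.
have [x0 fx0 fmax] := half_sup fb (ex_intro _ x1 fx1).
(* [u] has norm at most 1 and reaches 1/2 at [x0] *)
pose k := 2 * `|f x0|; have k0 : 0 < k by rewrite mulr_gt0// normr_gt0.
pose u x := k^-1 * f x.
have uE x : `|u x| = k^-1 * `|f x| by rewrite normrM gtr0_norm ?invr_gt0.
have Xu : X u.
  have := linX k^-1 0 f f Xf Xf; congr X; apply/funext => x.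
  by rewrite mul0r addr0.
have u1 x : `|u x| <= 1 by rewrite uE ler_pdivrMl// mulr1 fmax.
have fu x : `|f x| `^ rr s = k `^ rr s * `|u x| `^ rr s.
  by rewrite -powRM ?(ltW k0)// uE mulVKf// gt_eqF.
pose Eu r := E (fun x => `|u x| `^ r).
rewrite (averages_scale avgE (DXs f s Xf) (DXs u s Xu) fu) -/(Eu _).
rewrite (_ : mean _ = k `^ rr s * mean (fun j => `|u (xi j)| `^ rr s)); last first.
  by rewrite -meanZ; congr mean; apply/funext => j; exact: fu.
rewrite -mulrBr normrM (gtr0_norm (powR_gt0 _ k0)) mulrCA ler_pM2l ?powR_gt0//.
have Euq : 1 <= (2 * H) `^ q * Eu q.
  have := nikX u x0 Xu; rewrite uE /k invfM -mulrA mulVf ?normr_eq0// mulr1.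
  move=> /(ler_wpM2l (powR_ge0 2 q)); rewrite -powRM// divff// powR1.
  by rewrite mulrA -powRM// ltW.
have EuW : 1 <= W H * Eu (rr s).
  have H20 : 0 < 2 * H by rewrite mulr_gt0.
  case: {fu} s => /=.
    have young x : p / q * (2 * H) `^ q * `|u x| `^ q + (1 - p / q) <=
        W H * `|u x| `^ p.
      have := powR_compare q0 qp (mulr_ge0 (ltW H20) (normr_ge0 (u x))).
      rewrite !(@powRM _ (2 * H)) ?(ltW H20)// -/(W H) => yp; apply: le_trans yp.
      by rewrite le_eqVlt; apply/orP; left; apply/eqP; ring.
    have := averages_le avgE (DXs u false Xu) (DXs u true Xu) young.
    move=> Ep; apply: le_trans Ep; rewrite -/(Eu q).
    have pq0 : 0 <= p / q by rewrite divr_ge0// ltW.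
    by have := ler_wpM2l pq0 Euq; lra.
  apply: (le_trans Euq); rewrite ler_wpM2r//.
    have : 0 < (2 * H) `^ q * Eu q by exact: lt_le_trans Euq.
    by rewrite pmulr_rgt0 ?powR_gt0// => /ltW.
  by rewrite /W ler_powR//; lra.
have [i ui] := gP u Xu u1.
have close x : `| `|u x| `^ rr s - `|g i x| `^ rr s| <= eps H.
  have /andP[r1 rp] := rr1 s.
  apply: (le_trans (powR_lipschitz_norm r1 (u1 x) ((gX i).2 x))).
  apply: (@le_trans _ _ (p * (2 * t H))).
    by rewrite ler_pM// (le_trans _ r1).
  by rewrite /t le_eqVlt; apply/orP; left; apply/eqP; field; rewrite gt_eqF.
have Dg := DXs (g i) s (gX i).1; have Du := DXs u s Xu.
have lo x : 1 * `|u x| `^ rr s + - eps H <= 1 * `|g i x| `^ rr s.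
  by have := close x; rewrite ler_norml; lra.
have hi x : 1 * `|g i x| `^ rr s + - eps H <= 1 * `|u x| `^ rr s.
  by have := close x; rewrite ler_norml; lra.
have m0c : (0 < #|'I_m|)%N by rewrite card_ord.
have := averages_le avgE Du Dg lo; have := averages_le avgE Dg Du hi.
have := averages_le (averages_mean m0c) (f := fun j => `|u (xi j)| `^ rr s)
  (g := fun j => `|g i (xi j)| `^ rr s) I I (fun j => lo (xi j)).
have := averages_le (averages_mean m0c) (g := fun j => `|u (xi j)| `^ rr s)
  (f := fun j => `|g i (xi j)| `^ rr s) I I (fun j => hi (xi j)).
have : `|mean (fun j => `|g i (xi j)| `^ rr s) - E (fun x => `|g i x| `^ rr s)| <= eps H.
  have m0 : 0 < m%:R :> R by rewrite ltr0n.
  have := hxi (i, s); rewrite /mean card_ord /=.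
  set P := \sum_(_ < m) _; set Q := E _ => PQ.
  have -> : m%:R^-1 * P - Q = m%:R^-1 * (P - m%:R * Q).
    by rewrite mulrBr mulKf// gt_eqF.
  by rewrite normrM gtr0_norm ?invr_gt0// ler_pdivrMl.
have : 3 * eps H <= 20^-1 * Eu (rr s).
  have -> : 3 * eps H = 20^-1 * (W H)^-1 by rewrite /eps; field; rewrite gt_eqF.
  by rewrite ler_wpM2l// -[leLHS]mulr1 ler_pdivrMl.
rewrite -/(Eu _); set y := mean _; set z := mean _; rewrite !ler_norml; lra.
Qed.

End crude_discretization.

(** * Integration on finite product spaces *)

Section product_integration.
Context {R : realType} {I : finType} {disp : I -> measure_display}.
Variable T : forall i, measurableType (disp i).
Local Notation prodT := (product_space T).

Lemma measurable_coordinate i : measurable_fun [set: prodT] (fun x : prodT => x i : T i).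
Proof.
move=> _ Y mY; rewrite setTI; apply: sub_sigma_algebra.
by exists i, Y.
Qed.

Lemma measurable_to_product d (S : measurableType d) (F : S -> prodT) :
  (forall i, measurable_fun [set: S] (fun s => F s i : T i)) ->
  measurable_fun [set: S] F.
Proof.
move=> mF; apply: (@measurability _ _ S prodT setT F (@cylinder_set I disp T)) => //.
move=> _ [_ [i [B [mB ->]]] <-].
exact: (mF i).
Qed.

(** The boxes are stable under intersection and generate the sigma-algebra, so
    measures on the product are determined by their values on boxes. *)
Definition box : set (set prodT) :=
  [set A | exists B : forall i, set (T i), (forall i, measurable (B i)) /\
     A = [set x | forall i, B i (x i)]].

Lemma measurable_box A : box A -> measurable (A : set prodT).
Proof.
move=> [B [mB ->]].
rewrite (_ : [set x | _] = \bigcap_(i in [set: I]) [set x : prodT | B i (x i)]).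
  apply: fin_bigcap_measurable; first exact: finite_finset.
  by move=> i _; have := @measurable_coordinate i measurableT _ (mB i); rewrite setTI.
by apply/seteqP; split => [x xB i _|x xB i]; exact: xB.
Qed.

Lemma box_generates : measurable = <<s box >> :> set (set prodT).
Proof.
apply/seteqP; split; last first.
  apply: smallest_sub; first exact: sigma_algebra_measurable.
  by move=> A; exact: measurable_box.
apply: smallest_sub; first exact: smallest_sigma_algebra.
move=> _ [i [B [mB ->]]]; apply: sub_sigma_algebra.
exists (dfwith (fun j => [set: T j]) i B); split.
  by move=> j; case: dfwithP.
apply/seteqP; split => x /=.
  by move=> Bx j; case: dfwithP.
by move=> /(_ i); rewrite dfwithin.
Qed.

Lemma box_setI : setI_closed box.
Proof.
move=> _ _ [B [mB ->]] [C [mC ->]]; exists (fun i => B i `&` C i); split.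
  by move=> i; exact: measurableI.
apply/seteqP; split => x /=; first by move=> [xB xC] i; split.
by move=> xBC; split => i; have [] := xBC i.
Qed.

Variables (mu_ : forall i, probability (T i) R) (mu : probability prodT R).
Hypothesis hmu : is_product_measure mu_ mu.

Definition replace_coordinate i (w : prodT * T i) : prodT := dfwith w.1 i w.2.

Lemma measurable_replace_coordinate i :
  measurable_fun [set: prodT * T i] (@replace_coordinate i).
Proof.
apply: measurable_to_product => j; rewrite /replace_coordinate.
have [ij|ij] := eqVneq i j.
  move: ij => <-.
  have -> : (fun s : prodT * T i => dfwith s.1 i s.2 i) = snd.
    by apply/funext => s; rewrite dfwithin.
  exact: measurable_snd.
have -> : (fun s : prodT * T i => dfwith s.1 i s.2 j) = (fun s => s.1 j).
  by apply/funext => s; rewrite dfwithout.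
exact: (measurableT_comp (@measurable_coordinate j) measurable_fst).
Qed.

(** Resampling one coordinate of a point drawn from the product measure does
    not change its distribution, as can be checked on boxes. With Tonelli's
    theorem this lets one coordinate at a time be integrated out of the product
    measure without a decomposition of the product space. *)
Lemma integral_resample (i : I) (F : prodT -> \bar R) :
  measurable_fun [set: prodT] F -> (forall x, 0 <= F x)%E ->
  (\int[mu]_x F x = \int[mu]_x \int[mu_ i]_y F (dfwith (x : prodT) i y))%E.
Proof.
move=> mF F0.
have mrepl := @measurable_replace_coordinate i.
pose nu := pushforward (mu \x mu_ i)%E (@replace_coordinate i).
have nuE A : measurable A -> mu A = nu A.
  apply: (@measure_unique _ R prodT box (fun=> setT)).
  - exact: box_generates.
  - exact: box_setI.
  - move=> _; exists (fun i => setT); split => //.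
    by apply/seteqP; split.
  - by rewrite bigcup_const.
  - move=> _ [B [mB ->]].
    pose B' : forall j, set (T j) := dfwith B i [set: T i].
    have mB' j : measurable (B' j) by rewrite /B'; case: dfwithP.
    have pre : @replace_coordinate i @^-1` [set x | forall j, B j (x j)] =
        [set x : prodT | forall j, B' j (x j)] `*` B i.
      apply/seteqP; split => -[x y] /=; rewrite /replace_coordinate/=.
        move=> xB; split; last by have := xB i; rewrite dfwithin.
        move=> j; rewrite /B'; case: dfwithP => // k ik.
        by have := xB k; rewrite dfwithout.
      move=> [xB yB] j; case: dfwithP => // k ik.
      by have := xB k; rewrite /B' dfwithout.
    transitivity (\prod_j mu_ j (B j))%E; first exact: hmu.
    transitivity ((\prod_j mu_ j (B' j)) * mu_ i (B i))%E; last first.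
      have := hmu mB' => <-; rewrite /= /pushforward pre product_measure1E//.
      by apply: measurable_box; exists B'.
    rewrite (bigD1 i)//= [in RHS](bigD1 i)//= /B' dfwithin.
    rewrite probability_setT mul1e muleC; congr (_ * _)%E.
    by apply: eq_bigr => j ji; rewrite dfwithout// eq_sym.
  - move=> _; have := probability_setT mu; rewrite /= => ->; exact: ltry.
transitivity (\int[nu]_x F x)%E.
  apply: eq_measure_integral => A mA _; exact: nuE.
rewrite /nu (ge0_integral_pushforward mrepl)//.
rewrite preimage_setT fubini_tonelli1//; last by move=> w; exact: F0.
exact: (measurableT_comp mF mrepl).
Qed.

End product_integration.

(** * Nikol'skii inequality on the tensor product *)

Section integral_averages.
Context {d : measure_display} {T : measurableType d} {R : realType}.
Variable mu : probability T R.

Definition bounded_measurable : set (T -> R) :=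
  [set f : T -> R | measurable_fun [set: T] f /\ exists b : R, forall x, `|f x| <= b].

Lemma bounded_measurable_integrable f :
  bounded_measurable f -> mu.-integrable [set: T] (EFin \o f).
Proof.
move=> [mf [b fb]]; apply: measurable_bounded_integrable => //.
  by rewrite (le_lt_trans (probability_le1 _ _))// ltry.
exists b; split; first exact: num_real.
by move=> M bM x _ /=; exact: le_trans (fb x) (ltW bM).
Qed.

Lemma bounded_measurable_lin (a b : R) f g :
  bounded_measurable f -> bounded_measurable g ->
  bounded_measurable (fun x => a * f x + b * g x).
Proof.
move=> [mf [A fA]] [mg [B gB]]; split.
  by apply: measurable_funD; apply: measurable_funM.
exists (`|a| * A + `|b| * B) => x; apply: (le_trans (ler_normD _ _)).
by rewrite !normrM lerD// ler_wpM2l.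
Qed.

(** A function that exceeds its mean everywhere would have a positive excess
    with integral 0. *)
Lemma averages_Rintegral :
  averages bounded_measurable (fun f => \int[mu]_x f x).
Proof.
move=> I c f Df; apply: contrapT => /forallNP no.
have {}no x : \sum_i c i * \int[mu]_x f i x < \sum_i c i * f i x.
  by rewrite ltNge; apply/negP; exact: no.
have D1 (k : R) : bounded_measurable (fun=> k).
  by split; [exact: measurable_cst|exists `|k|].
have intS (s : seq I) : bounded_measurable (fun x => \sum_(i <- s) c i * f i x) /\
    \int[mu]_x (\sum_(i <- s) c i * f i x) = \sum_(i <- s) c i * \int[mu]_x f i x.
  elim: s => [|i s [Ds IH]].
    split; first by under eq_fun do rewrite big_nil; exact: D1.
    by under eq_Rintegral do rewrite big_nil; rewrite Rintegral_cst// mul0r big_nil.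
  have Di := bounded_measurable_lin (c i) 0 (Df i) (Df i).
  split.
    under eq_fun do rewrite big_cons.
    have := bounded_measurable_lin (c i) 1 (Df i) Ds.
    by under eq_fun do rewrite mul1r.
  under eq_Rintegral do rewrite big_cons.
  rewrite RintegralD//.
  - by rewrite RintegralZl ?IH ?big_cons//; exact: bounded_measurable_integrable.
  - apply: bounded_measurable_integrable.
    by move: Di; under eq_fun do rewrite mul0r addr0.
  - exact: bounded_measurable_integrable.
have [DF intF] := intS (index_enum I).
set v := \sum_i c i * _ in no intF.
pose g x := \sum_i c i * f i x - v.
have Dg : bounded_measurable g.
  have := bounded_measurable_lin 1 (-1) DF (D1 v).
  by under eq_fun do rewrite mul1r mulN1r.
have g0 x : 0 < g x by rewrite subr_gt0.
have intg : \int[mu]_x g x = 0.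
  rewrite /g RintegralB//; try exact: bounded_measurable_integrable.
  rewrite intF Rintegral_cst//; have := probability_setT mu => /= ->.
  by rewrite mulr1 subrr.
have : (\int[mu]_x `|(g x)%:E| = 0)%E.
  under eq_integral do rewrite gee0_abs ?lee_fin ?(ltW (g0 _))//.
  rewrite -[LHS]fineK; last first.
    by apply: integrable_fin_num => //; exact: bounded_measurable_integrable.
  by rewrite -/(Rintegral mu setT g) intg.
move/ae_eq_integral_abs => /(_ measurableT).
have mg : measurable_fun setT (EFin \o g) by apply/measurable_EFinP; case: Dg.
move=> /(_ mg) [A [mA A0 sub]].
have : (mu [set: T] <= mu A)%E.
  apply: le_measure; rewrite ?inE// => x _; apply: sub => /=.
  by move=> /(_ Logic.I)[] /eqP; rewrite gt_eqF.
by have := probability_setT mu => /= ->; rewrite A0 leNgt lte01.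
Qed.

End integral_averages.

Section tensor_nikolskii.
Context {R : realType} {s : nat} {disp : 'I_s -> measure_display}.
Variable T : forall i, measurableType (disp i).
Local Notation prodT := (product_space T).
Variables (mu_ : forall i, probability (T i) R) (mu : probability prodT R).
Hypothesis hmu : is_product_measure mu_ mu.
Variable X : forall i : 'I_s, set (T i -> R).
Arguments X : clear implicits.
Hypothesis linX : forall i : 'I_s, linear_class (X i).
Hypothesis X0 : forall i : 'I_s, X i (fun=> 0).
Hypothesis measX : forall (i : 'I_s) f, X i f -> measurable_fun [set: T i] f.

Lemma measurable_tensor_space (f : prodT -> R) :
  tensor_space X f -> measurable_fun [set: prodT] f.
Proof.
move=> [n [c [a [aX ->]]]].
have -> : \sum_k c k *: a k = fun x => \sum_k c k * a k x.
  by apply/funext => x; rewrite fct_sumE.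
apply: measurable_sum => k; apply: measurable_funM => //.
have [g Xg <-] := aX k; apply: measurable_prod => i _.
exact: (measurableT_comp (measX (Xg i)) (@measurable_coordinate _ _ T i)).
Qed.

Lemma linear_class_sum (i : 'I_s) n (c : 'I_n -> R) (g : 'I_n -> T i -> R) :
  (forall k, X i (g k)) -> X i (fun y => \sum_k c k * g k y).
Proof.
elim: n c g => [|n IH] c g Xg.
  by under eq_fun do rewrite big_ord0; exact: X0.
under eq_fun do rewrite big_ord_recl.
have := linX (c ord0) 1 (Xg ord0)
  (IH (fun k => c (lift ord0 k)) (fun k => g (lift ord0 k)) (fun k => Xg _)).
by under eq_fun do rewrite mul1r.
Qed.

Lemma tensor_space_slice (f : prodT -> R) (i : 'I_s) (x : prodT) :
  tensor_space X f -> X i (fun y => f (dfwith x i y)).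
Proof.
move=> [n [c [a [aX ->]]]].
have /choice[g hg] : forall k, exists g, (forall i, X i (g i)) /\ tensor_fun g = a k.
  by move=> k; have [g Xg <-] := aX k; exists g.
have -> : (fun y => (\sum_k c k *: a k) (dfwith x i y)) =
    fun y => \sum_k (c k * \prod_(j | j != i) g k j (x j)) * g k i y.
  apply/funext => y; rewrite fct_sumE; apply: eq_bigr => k _ /=.
  rewrite -(hg k).2; transitivity (c k * \prod_j g k j (dfwith x i y j)) => //.
  rewrite (bigD1 i)//= dfwithin -mulrA [g k i y * _]mulrC; congr (_ * (_ * _)).
  by apply: eq_bigr => j ji; rewrite dfwithout// eq_sym.
by apply: linear_class_sum => k; exact: (hg k).1.
Qed.

Variables (q : R) (K : 'I_s -> R).
Hypothesis K0 : forall i, 0 <= K i.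
Hypothesis nikX : forall (i : 'I_s) f x, X i f ->
  ((`|f x| `^ q)%:E <= (K i)%:E * \int[mu_ i]_y (`|f y| `^ q)%:E)%E.

(* the point with the first [k] coordinates of [z] and the others of [x] *)
Let mix (k : nat) (z x : prodT) : prodT := fun i => if (i < k)%N then z i else x i.

Let measurable_mix k x : measurable_fun [set: prodT] (fun z => mix k z x).
Proof.
apply: measurable_to_product => i; rewrite /mix; case: (i < k)%N.
  exact: measurable_coordinate.
exact: measurable_cst.
Qed.

(** The coordinates are integrated out one at a time: each slice of [f] is in
    the one-variable space, and the slice variable is then absorbed in the
    product measure by resampling. *)
Lemma tensor_nikolskii (f : prodT -> R) (x : prodT) : tensor_space X f ->
  ((`|f x| `^ q)%:E <= (\prod_i K i)%:E * \int[mu]_z (`|f z| `^ q)%:E)%E.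
Proof.
move=> Xf; have mf := measurable_tensor_space Xf.
have mG : measurable_fun [set: prodT] (fun w => (`|f w| `^ q)%:E).
  apply/measurable_EFinP.
  apply: (measurableT_comp (measurable_powR q)).
  exact: measurableT_comp.
have G0 w : (0 <= (`|f w| `^ q)%:E)%E by rewrite lee_fin powR_ge0.
have step k : (k <= s)%N ->
    ((`|f x| `^ q)%:E <= (\prod_(i < s | (i < k)%N) K i)%:E *
      \int[mu]_z (`|f (mix k z x)| `^ q)%:E)%E.
  elim: k => [|k IH] ks.
    rewrite big_pred0// mul1e (_ : (fun z => _) = cst (`|f x| `^ q)%:E).
      rewrite integral_cst//; have := probability_setT mu => /= ->.
      by rewrite mule1.
    by apply/funext => z.
  apply: (le_trans (IH (ltnW ks))).
  pose i := Ordinal ks.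
  have -> : \prod_(j < s | (j < k.+1)%N) K j = (\prod_(j < s | (j < k)%N) K j) * K i.
    rewrite (bigD1 i)//= mulrC; congr (_ * _); apply: eq_bigl => j.
    by rewrite ltnS -val_eqE/= ltn_neqAle andbC.
  rewrite EFinM -muleA; apply: lee_pmul => //.
  - by rewrite lee_fin prodr_ge0.
  - by apply: integral_ge0 => z _.
  pose F (w : prodT) := (`|f (mix k.+1 w x)| `^ q)%:E.
  have mF : measurable_fun [set: prodT] F.
    exact: (measurableT_comp mG (@measurable_mix k.+1 x)).
  have F0 w : (0 <= F w)%E by exact: G0.
  have mFu : measurable_fun [set: prodT * T i] (fun w => F (dfwith w.1 i w.2)).
    exact: (measurableT_comp mF (@measurable_replace_coordinate _ _ T i)).
  rewrite (integral_resample hmu i mF F0).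
  rewrite -ge0_integralZl//; last 3 first.
  - exact: (measurable_fun_fubini_tonelli_F _ mFu).
  - by move=> z _; apply: integral_ge0 => y _; exact: F0.
  - by rewrite lee_fin.
  apply: ge0_le_integral => //.
  - exact: (measurableT_comp mG (@measurable_mix k x)).
  - apply: measurable_funeM; exact: (measurable_fun_fubini_tonelli_F _ mFu).
  move=> z _.
  have := nikX (x i) (tensor_space_slice i (mix k z x) Xf).
  have -> : dfwith (mix k z x) i (x i) = mix k z x.
    by apply: functional_extensionality_dep => j; case: dfwithP => //; rewrite /mix ltnn.
  have -> // : (fun y => (`|f (dfwith (mix k z x) i y)| `^ q)%:E) =
      (fun y => F (dfwith z i y)).
  apply/funext => y; rewrite /F.
  suff -> : dfwith (mix k z x) i y = mix k.+1 (dfwith z i y) x by [].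
  apply: functional_extensionality_dep => j; rewrite [RHS]/mix.
  case: dfwithP => [|j' ij]; first by rewrite /= ltnSn dfwithin.
  rewrite dfwithout// /mix ltnS [(j' <= k)%N]leq_eqVlt.
  by rewrite (_ : (j' == k :> nat) = false)//; apply/negbTE; rewrite eq_sym.
apply: (le_trans (step s (leqnn s))).
have -> : \prod_(i < s | (i < s)%N) K i = \prod_i K i.
  by apply: eq_bigl => i; rewrite ltn_ord.
rewrite (_ : (fun z => _) = (fun z => (`|f z| `^ q)%:E))//.
apply/funext => z; suff -> : mix s z x = z by [].
by apply: functional_extensionality_dep => i; rewrite /mix ltn_ord.
Qed.

End tensor_nikolskii.

(** * Dimension of the tensor product *)

Section spans.
Context {R : realType}.

Lemma lin_span0 {V : lmodType R} (A : set V) : lin_span A 0.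
Proof.
exists 0%N, (fun=> 0), (fun=> 0); split; first by case.
by rewrite big_ord0.
Qed.

Lemma lin_span_lin {V : lmodType R} (A : set V) (a b : R) (u v : V) :
  lin_span A u -> lin_span A v -> lin_span A (a *: u + b *: v).
Proof.
move=> [n1 [c1 [w1 [A1 ->]]]] [n2 [c2 [w2 [A2 ->]]]].
exists (n1 + n2)%N.
exists (fun k => match fintype.split k with inl i => a * c1 i | inr j => b * c2 j end).
exists (fun k => match fintype.split k with inl i => w1 i | inr j => w2 j end).
split; first by move=> k; case: fintype.split.
rewrite big_split_ord !scaler_sumr; congr (_ + _); apply: eq_bigr => k _.
  by rewrite (unsplitK (inl k)) scalerA.
by rewrite (unsplitK (inr k)) scalerA.
Qed.

Lemma linear_class_lin_span {T : Type} (A : set (T -> R)) :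
  linear_class (lin_span A).
Proof.
move=> a b f g Af Ag; exact: (@lin_span_lin (T -> R) A a b f g Af Ag).
Qed.

Lemma lin_span_range {T : Type} n (e : 'I_n -> T -> R) f :
  lin_span (range e) f ->
  exists c : 'I_n -> R, forall x, f x = \sum_k c k * e k x.
Proof.
move=> [m [c [a [ae ->]]]].
have /choice[i iE] : forall k, exists j, e j = a k by move=> k; have [j _ <-] := ae k; exists j.
exists (fun j => \sum_(k | i k == j) c k) => x.
rewrite fct_sumE; under [RHS]eq_bigr do rewrite mulr_suml.
rewrite (exchange_big_dep xpredT)//=; apply: eq_bigr => k _.
by rewrite (big_pred1 (i k)) ?iE// => j; rewrite eq_sym.
Qed.

Lemma lin_span_sub {V : lmodType R} (A : set V) v : A v -> lin_span A v.
Proof.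
move=> Av; exists 1%N, (fun=> 1), (fun=> v); split => //.
by rewrite big_ord_recl big_ord0 scale1r addr0.
Qed.

Section tensor_span.
(* The spanning functions of each factor are indexed by [nat], with values of
   interest below [N i] only: the product of the sums over them then distributes
   over the non-dependent functions from [I] to one common ['I_M]. *)
Context {I : finType} {T : I -> Type}.
Variables (X : forall i, set (T i -> R)) (N : I -> nat)
  (e : forall i, nat -> T i -> R).
Arguments X : clear implicits.
Arguments e : clear implicits.
Hypothesis spanX : forall i f, X i f ->
  exists c : nat -> R, forall x, f x = \sum_(j < N i) c j * e i j x.

Let M := (\sum_i N i)%N.
Let F : {set {ffun I -> 'I_M}} := [set phi : {ffun I -> 'I_M} | [forall i, (phi i < N i)%N]].

Definition tensor_basis (k : 'I_#|F|) : (forall i, T i) -> R :=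
  tensor_fun (fun i => e i (enum_val k i)).

Lemma card_tensor_basis : #|F| = (\prod_i N i)%N.
Proof.
have -> : #|F| = #|family (fun i => [pred j : 'I_M | (j < N i)%N])|.
  by apply: eq_card => phi; rewrite inE.
rewrite card_family foldrE big_map big_enum /=; apply: eq_bigr => i _.
rewrite -sum1_card -(big_ord_widen M (fun=> 1%N)) ?sum1_card ?card_ord//.
by rewrite /M (bigD1 i)//= leq_addr.
Qed.

Lemma tensor_space_span f : tensor_space X f ->
  exists c : 'I_#|F| -> R, forall x, f x = \sum_k c k * tensor_basis k x.
Proof.
have NM i : (N i <= M)%N by rewrite /M (bigD1 i)//= leq_addr.
have one g : (forall i, X i (g i)) ->
    exists c : 'I_#|F| -> R, forall x,
      tensor_fun g x = \sum_k c k * tensor_basis k x.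
  move=> Xg.
  have /choice[c hc] : forall i, exists c : nat -> R, forall x,
      g i x = \sum_(j < N i) c j * e i j x by move=> i; exact: spanX.
  exists (fun k : 'I_#|F| => \prod_i c i (enum_val k i)) => x.
  rewrite /tensor_fun; under eq_bigr do rewrite hc.
  under eq_bigr => i _ do rewrite (big_ord_widen M (fun j => c i j * e i j (x i)))//.
  rewrite bigA_distr_big_dep /=.
  rewrite (eq_bigl (fun phi => phi \in F)); last first.
    move=> phi; apply/familyP/idP => [h|]; first by rewrite inE; apply/forallP.
    by rewrite inE => /forallP.
  rewrite big_enum_val /=; apply: eq_bigr => k _.
  by rewrite big_split.
move=> [n [c [a [aX ->]]]].
have /choice[b hb] : forall k, exists b : 'I_#|F| -> R, forall x,
    a k x = \sum_j b j * tensor_basis j x.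
  by move=> k; have [g Xg <-] := aX k; exact: one.
exists (fun j => \sum_k c k * b k j) => x.
rewrite fct_sumE; under [RHS]eq_bigr do rewrite mulr_suml.
rewrite exchange_big /=; apply: eq_bigr => k _.
rewrite -[LHS]/(c k * a k x) hb mulr_sumr; apply: eq_bigr => j _.
by rewrite mulrA.
Qed.

Lemma tensor_basis_bounded :
  (forall i j, exists b : R, forall x, `|e i j x| <= b) ->
  forall k, exists b : R, forall x, `|tensor_basis k x| <= b.
Proof.
move=> eb k.
have /choice[b hb] : forall i, exists b : R, forall x, `|e i (enum_val k i) x| <= b.
  by move=> i; exact: eb.
exists (\prod_i b i) => x; rewrite /tensor_basis /tensor_fun normr_prod.
by apply: ler_prod => i _; rewrite normr_ge0 hb.
Qed.

End tensor_span.

End spans.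

(** * Sampling of a space with a Nikol'skii inequality *)

Section product_discretization.
Context {R : realType}.

Lemma ln2_bounds : 0 < (ln 2 : R) <= 1.
Proof.
rewrite ln_gt0 ?ltr1n//=.
by have := @le_ln1Dx R 1; rewrite -[1 + 1]/(2 : R); apply; lra.
Qed.

Lemma ln_log2 (x : R) : 1 <= x -> ln x <= log2 x.
Proof.
have /andP[l0 l1] := ln2_bounds; move=> x1.
by rewrite /log2 ler_pdivlMr// ler_piMr// ln_ge0.
Qed.

Lemma log2_ge1 (x : R) : 2 <= x -> 1 <= log2 x.
Proof.
have /andP[l0 l1] := ln2_bounds; move=> x2.
by rewrite /log2 ler_pdivlMr// mul1r ler_ln ?posrE//; lra.
Qed.

Lemma le_exp2_log2 (x : R) (k : nat) : 1 <= x -> log2 x <= k%:R -> x <= 2 ^+ k.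
Proof.
have /andP[l0 l1] := ln2_bounds; move=> x1.
rewrite /log2 ler_pdivrMr// => h.
rewrite -[leLHS]lnK ?posrE ?(lt_le_trans _ x1)// -[leRHS]lnK ?posrE ?exprn_gt0//.
by rewrite ler_expR lnXn// -[_ *+ k]mulr_natl.
Qed.

(** The origin of the third power of the logarithm. The first sampling has
    polynomially many points [n], so [ln n] is of order [log2 R0]; so is the
    number [J] of layers, which enters squared because the error is shared
    equally between the layers. *)
Lemma log_budget (p C1 C2 : R) : 2 <= p -> 0 < C1 -> 0 < C2 ->
  exists2 C : R, 0 < C & forall (H R0 Nr : R) (n : nat),
  2 <= R0 -> 1 <= H -> H <= R0 -> 0 <= Nr <= R0 -> 
  n%:R <= C2 * (Nr ^+ 2 * H * (H `^ p) ^+ 2) ->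
  exists J : nat, [/\ (0 < J)%N, 2 * H / 2 ^+ J <= 40^-1 &
    C1 * J%:R ^+ 2 * (2 * H) `^ p * (ln (4 * J)%:R + ln (2 * n).+1%:R) <=
      C * H `^ p * log2 R0 ^+ 3].
Proof.
move=> p2 C10 C20.
pose c3 : R := 3 * (C2 + 1) + 3 + 2 * p.
exists (C1 * 9 ^+ 2 * 2 `^ p * (36 + c3)).
  by rewrite !mulr_gt0 ?powR_gt0// /c3 !addr_gt0 ?mulr_gt0 ?addr_gt0// (lt_le_trans _ p2).
move=> H R0 Nr n R02 H1 HR /andP[Nr0 NR] hn.
have H0 : 0 < H by exact: lt_le_trans H1.
have R00 : 0 < R0 by exact: lt_le_trans R02.
have p0 : 0 <= p by exact: le_trans p2.
have R01 : 1 <= R0 by apply: le_trans R02; rewrite ler1n.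
pose L := log2 R0; have L1 : 1 <= L by exact: log2_ge1.
have L0 : 0 <= L by exact: le_trans L1.
(* [2^J >= 2^7 * R0], and [2^7 >= 80] *)
pose J := (8 + Num.truncn L)%N.
have JL : J%:R <= 9 * L.
  have : (Num.truncn L)%:R <= L by rewrite truncn_le.
  by rewrite /J natrD; move: (Num.truncn L)%:R; clear -L1 => y; lra.
have LJ : R0 <= 2 ^+ (Num.truncn L).+1.
  by apply: le_exp2_log2 => //; rewrite ltW// truncnS_gt.
exists J; split => //.
  rewrite ler_pdivrMr ?exprn_gt0//.
  have -> : 2 ^+ J = 2 ^+ 7 * 2 ^+ (Num.truncn L).+1 :> R by rewrite -exprD addnS.
  have k2 : 2 <= 40^-1 * 2 ^+ 7 :> R.
    by rewrite ler_pdivlMl// -natrX -natrM ler_nat.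
  rewrite mulrA; apply: ler_pM => //; first exact: ltW.
  exact: le_trans LJ.
have J0 : 0 < J%:R :> R by rewrite ltr0n.
clearbody J.
have l1 : ln (4 * J)%:R <= 36 * L.
  rewrite natrM; have J4 : 0 < 4 * J%:R :> R by rewrite mulr_gt0.
  by apply: (le_trans (ltW (ln_sublinear J4))); clear -JL; lra.
have Hp0 : 0 <= H `^ p by exact: powR_ge0.
have HpR : H `^ p <= R0 `^ p.
  by apply: ge0_ler_powR; rewrite ?nnegrE// ltW.
have nR : n%:R <= C2 * (R0 ^+ 3 * (R0 `^ p) ^+ 2).
  apply: (le_trans hn); rewrite ler_pM2l// [R0 ^+ 3]exprSr.
  apply: ler_pM; rewrite ?mulr_ge0 ?exprn_ge0//; first exact: ltW.
    by apply: ler_pM; rewrite ?exprn_ge0 ?(ltW H0)// lerXn2r ?nnegrE// ltW.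
  by rewrite lerXn2r ?nnegrE ?powR_ge0.
have l2 : ln (2 * n).+1%:R <= c3 * L.
  have R0p : 0 < R0 `^ p by exact: powR_gt0.
  have C3 : 0 < 3 * (C2 + 1) by rewrite mulr_gt0// addr_gt0.
  have big1 : 1 <= R0 ^+ 3 * (R0 `^ p) ^+ 2.
    rewrite -[leLHS]mulr1 ler_pM// exprn_ege1//.
    by rewrite -[leLHS](powRr0 R0) ler_powR.
  apply: (@le_trans _ _ (ln (3 * (C2 + 1) * (R0 ^+ 3 * (R0 `^ p) ^+ 2)))).
    rewrite ler_ln ?posrE ?mulr_gt0 ?exprn_gt0// ?addr_gt0//.
    rewrite -[_.+1%:R]natr1 natrM; move: nR.
    move: (R0 ^+ 3 * (R0 `^ p) ^+ 2) big1 => y y1 ny.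
    have : 0 <= C2 * y by rewrite mulr_ge0 ?(ltW C20)// (le_trans _ y1).
    by clear -y1 ny; lra.
  have -> : ln (3 * (C2 + 1) * (R0 ^+ 3 * (R0 `^ p) ^+ 2)) =
      ln (3 * (C2 + 1)) + (3%:R * ln R0 + 2%:R * (p * ln R0)).
    have y0 : 0 < R0 ^+ 3 * (R0 `^ p) ^+ 2 by rewrite mulr_gt0 ?exprn_gt0.
    rewrite lnM ?posrE//; congr (_ + _).
    by rewrite lnM ?posrE ?exprn_gt0// !lnXn// ln_powR !mulr_natl.
  have := ln_sublinear C3; have := ln_log2 R01; rewrite -/L => lL lC.
  have lp : p * ln R0 <= p * L by rewrite ler_wpM2l.
  have cL : 3 * (C2 + 1) <= 3 * (C2 + 1) * L by rewrite ler_peMr// ltW.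
  rewrite /c3; clear -lL lC lp cL; lra.
apply: (@le_trans _ _ (C1 * (9 * L) ^+ 2 * (2 * H) `^ p * (36 * L + c3 * L))).
  have J9 : J%:R ^+ 2 <= (9 * L) ^+ 2.
    by rewrite lerXn2r ?nnegrE ?(mulr_ge0 _ L0).
  apply: ler_pM.
  - apply: mulr_ge0; last exact: powR_ge0.
    by apply: mulr_ge0; [exact: ltW|apply: exprn_ge0; exact: ltW].
  - have Jn : (0 < J)%N by rewrite -(ltr0n R).
    by apply: addr_ge0; apply: ln_ge0; rewrite ler1n// muln_gt0.
  - apply: ler_wpM2r; first exact: powR_ge0.
    by apply: ler_wpM2l J9; exact: ltW.
  - exact: lerD.
rewrite powRM ?(ltW H0)// -/L.
by rewrite le_eqVlt; apply/orP; left; apply/eqP; ring.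
Qed.

End product_discretization.

Section two_step_sampling.
Context {R : realType}.

(** The space seen on the points of the first sampling satisfies the Nikol'skii
    inequality with [2 * H] in place of [H], since the [L_q] norms are preserved
    there; the second sampling is a subsample of the first. Relative errors 1/20
    and 1/5 combine to less than 1/2. *)
Lemma two_step_sampling (p q : R) : 2 <= q -> q <= p ->
  exists2 C : R, 0 < C &
  forall (T : Type) (D : set (T -> R)) (E : (T -> R) -> R) (N : nat)
    (e : 'I_N -> T -> R) (X : set (T -> R)) (H R0 : R),
  averages D E -> (0 < N)%N -> 1 <= H -> 2 <= R0 -> H <= R0 -> N%:R <= R0 ->
  linear_class X -> X (fun=> 0) ->
  (forall k, exists b : R, forall x, `|e k x| <= b) ->
  (forall f, X f -> exists c, forall x, f x = \sum_k c k * e k x) ->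
  (forall f r, X f -> r = p \/ r = q ->
     D (fun x => `|f x| `^ r) /\ D (fun x => (`|f x| `^ r) ^+ 2)) ->
  (forall f x, X f -> `|f x| `^ q <= H `^ q * E (fun y => `|f y| `^ q)) ->
  exists m (xi : 'I_m -> T), [/\ (0 < m)%N,
    m%:R <= C * H `^ p * log2 R0 ^+ 3 &
    forall f, X f ->
      2^-1 * E (fun x => `|f x| `^ p) <= mean (fun j => `|f (xi j)| `^ p) <=
        3 / 2 * E (fun x => `|f x| `^ p)].
Proof.
move=> q2 qp.
have q0 : 0 < q by exact: lt_le_trans q2.
have p0 : 0 < p by exact: lt_le_trans qp.
have p2 : 2 <= p by exact: le_trans qp.
have [C2 C20 crude] := crude_discretization q2 qp.
have [C1 C10 fine] := finite_discretization q2 qp.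
have [C C0 budget] := log_budget p2 C10 C20.
exists (C + 1); first by rewrite addr_gt0.
move=> T D E N e X H R0 avgE N0 H1 R02 HR NR linX X0 eb Xe DX nikX.
have H0 : 0 < H by exact: lt_le_trans H1.
have [n [x [n0 nle xP]]] := crude T D E N e X H avgE N0 H1 linX X0 eb Xe DX nikX.
have [|J [J0 HJ mle]] := budget H R0 N%:R n R02 H1 HR _ nle; first by rewrite ler0n.
(* the restriction of [X] to the points of the first sampling *)
pose Y := [set g | exists2 f, X f & g = (fun j => f (x j))].
have nc : (0 < #|'I_n|)%N by rewrite card_ord.
have linY : linear_class Y.
  move=> a b _ _ [f Xf ->] [g Xg ->].
  by exists (fun y => a * f y + b * g y) => //; exact: linX.
have Y0 : Y (fun=> 0) by exists (fun=> 0).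
have nikY g j : Y g -> `|g j| `^ q <= (2 * H) `^ q * mean (fun k => `|g k| `^ q).
  move=> [f Xf ->]; apply: (le_trans (nikX f (x j) Xf)).
  rewrite powRM ?(ltW H0)// [_ * H `^ q]mulrC -mulrA ler_wpM2l ?powR_ge0//.
  have := xP f q Xf (or_intror erefl); rewrite ler_norml => /andP[lo _].
  have two : 2 <= 2 `^ q :> R.
    by rewrite -[leLHS]powRr1// ler_powR ?ler1n// (le_trans _ q2)// ler1n.
  have M0 : 0 <= mean (fun k => `|f (x k)| `^ q).
    by apply: mean_ge0 => // k; exact: powR_ge0.
  by move: (ler_wpM2r M0 two) lo; clear -M0; lra.
pose m := (Num.truncn (C * H `^ p * log2 R0 ^+ 3)).+1.
have L1 : 1 <= log2 R0 by exact: log2_ge1.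
have Hp1 : 1 <= H `^ p by rewrite -[leLHS](powRr0 H) ler_powR// ltW.
have B0 : 0 <= C * H `^ p * log2 R0 ^+ 3.
  apply: mulr_ge0; last by rewrite exprn_ge0// (le_trans _ L1).
  by apply: mulr_ge0; [exact: ltW|exact: powR_ge0].
have H21 : 1 <= 2 * H by clear -H1; lra.
have [|m0 [z zP]] := fine 'I_n (2 * H) Y J m nc H21 linY Y0 nikY J0 HJ.
  rewrite card_ord; apply: (le_trans mle); apply: ltW; exact: truncnS_gt.
exists m, (fun j => x (z j)); split => //.
  rewrite /m -[(Num.truncn _).+1%:R]natr1 [(C + 1) * _]mulrDl mul1r [leRHS]mulrDl.
  by rewrite lerD ?truncn_le// -[leLHS]mulr1 ler_pM// exprn_ege1.
move=> f Xf; have Yf : Y (fun j => f (x j)) by exists f.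
have := zP _ Yf; have := xP f p Xf (or_introl erefl).
rewrite !ler_norml => /andP[a1 a2] /andP[b1 b2].
have E0 : 0 <= E (fun x => `|f x| `^ p).
  have [Df _] := DX f p Xf (or_introl erefl).
  have := averages_le avgE (a := 0) (b := 1) (c := 0) Df Df.
  by rewrite mul0r mul1r addr0; apply => y; rewrite mul0r mul1r addr0 powR_ge0.
by clear -a1 a2 b1 b2 E0; apply/andP; split; lra.
Qed.

End two_step_sampling.

(** * Sampling of tensor products *)

Section product_sampling.
Context {R : realType}.

Lemma product_sampling (p q : R) : 2 <= q -> q <= p ->
  exists2 C : R, 0 < C &
  forall (s : nat) (disp : 'I_s -> measure_display)
    (T : forall i, measurableType (disp i))
    (mu_ : forall i, probability (T i) R)
    (mu : probability (product_space T) R)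
    (N : 'I_s -> nat) (X : forall i, set (T i -> R))
    (e : forall i, nat -> T i -> R) (B : 'I_s -> R),
  is_product_measure mu_ mu ->
  (forall i, (0 < N i)%N) ->
  (forall i, linear_class (X i)) -> (forall i, X i (fun=> 0)) ->
  (forall i f, X i f -> measurable_fun [set: T i] f) ->
  (forall i j, exists b : R, forall x, `|e i j x| <= b) ->
  (forall i f, X i f ->
     exists c : nat -> R, forall x, f x = \sum_(j < N i) c j * e i j x) ->
  (forall i, 1 <= B i) ->
  (forall i f x, X i f -> ((`|f x| `^ q)%:E <=
     ((B i * (N i)%:R `^ q^-1) `^ q)%:E * \int[mu_ i]_y (`|f y| `^ q)%:E)%E) ->
  exists m (xi : 'I_m -> product_space T), [/\ (0 < m)%N,
    m%:R <= C * (\prod_i (B i `^ p * (N i)%:R `^ (p / q))) *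
                (log2 (2 * \prod_i (B i * (N i)%:R))) ^+ 3 &
    forall f, tensor_space X f ->
      mu.-integrable setT (fun x => (`|f x| `^ p)%:E) /\
      2^-1 * (\int[mu]_x (`|f x| `^ p)) <=
        m%:R^-1 * \sum_j `|f (xi j)| `^ p <=
        3 / 2 * (\int[mu]_x (`|f x| `^ p))].
Proof.
move=> q2 qp; have q0 : 0 < q by exact: lt_le_trans q2.
have p0 : 0 < p by exact: lt_le_trans qp.
have [C C0 sampling] := two_step_sampling q2 qp.
exists C => // s disp T mu_ mu N X e B hmu N0 linX X0 measX eb spanX B1 nikX.
have N1 i : 1 <= (N i)%:R :> R by rewrite ler1n.
have B0 i : 0 <= B i by exact: le_trans (B1 i).
pose H := \prod_i (B i * (N i)%:R `^ q^-1).
pose R0 := 2 * \prod_i (B i * (N i)%:R).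
have q1 : q^-1 <= 1 by rewrite invf_le1// (le_trans _ q2)// ler1n.
have qV0 : 0 <= q^-1 by rewrite invr_ge0 ltW.
have Nq1 i : 1 <= (N i)%:R `^ q^-1 by rewrite -[leLHS](powRr0 (N i)%:R) ler_powR.
have BN1 i : 1 <= B i * (N i)%:R by rewrite -[leLHS]mulr1 ler_pM.
have H1 : 1 <= H.
  by apply: prod_ge1 => i; rewrite -[leLHS]mulr1 ler_pM.
have P1 : 1 <= \prod_i (B i * (N i)%:R) by exact: prod_ge1.
have R02 : 2 <= R0 by rewrite /R0 ler_peMr.
have PR : \prod_i (B i * (N i)%:R) <= R0.
  by rewrite /R0 ler_peMl ?ler1n// (le_trans _ P1).
have HR : H <= R0.
  apply: le_trans PR; apply: ler_prod => i _.
  by rewrite mulr_ge0 ?powR_ge0//= ler_wpM2l// ler1_powR.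
have NR : (\prod_i N i)%N%:R <= R0.
  apply: le_trans PR; rewrite natr_prod; apply: ler_prod => i _.
  by rewrite ler0n/= ler_peMl.
have HpE : H `^ p = \prod_i (B i `^ p * (N i)%:R `^ (p / q)).
  rewrite /H powR_prod; last by move=> i; rewrite mulr_ge0 ?powR_ge0.
  by apply: eq_bigr => i _; rewrite powRM ?powR_ge0// -powRrM [q^-1 * p]mulrC.
rewrite -HpE.
have NE := card_tensor_basis N.
have bddX (f : product_space T -> R) : tensor_space X f -> bounded_measurable f.
  move=> Xf; split; first exact: measurable_tensor_space measX _ Xf.
  have [c cE] := tensor_space_span spanX Xf.
  have [b hb] := bounded_combination c (tensor_basis_bounded (N:=N) eb).
  by exists b => x; rewrite cE.
have bddP (f : product_space T -> R) r : 0 < r -> tensor_space X f ->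
    bounded_measurable (fun x => `|f x| `^ r).
  move=> r0 /bddX[mf [b fb]]; split.
    by apply: (measurableT_comp (measurable_powR r)); exact: measurableT_comp.
  exists (b `^ r) => x; rewrite ger0_norm ?powR_ge0//.
  apply: ge0_ler_powR; rewrite ?nnegrE ?(ltW r0)//.
  by rewrite (le_trans _ (fb x)).
have intE (f : product_space T -> R) r : 0 < r -> tensor_space X f ->
    (\int[mu]_x (`|f x| `^ r)%:E = (\int[mu]_x (`|f x| `^ r))%:E)%E.
  move=> r0 Xf; rewrite /Rintegral fineK//; apply: integrable_fin_num => //.
  by apply: bounded_measurable_integrable; exact: bddP.
have [|||||||||||m [xi [m0 mle hxi]]] := sampling (product_space T) bounded_measurable
    (fun f => \int[mu]_x f x) _ (tensor_basis (N:=N) e) (tensor_space X) H R0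
    (averages_Rintegral mu).
- by rewrite NE prodn_gt0.
- exact: H1.
- exact: R02.
- exact: HR.
- by rewrite NE.
- exact: linear_class_lin_span.
- exact: lin_span0.
- exact: tensor_basis_bounded.
- by move=> f; exact: tensor_space_span.
- move=> f r Xf hr; have r0 : 0 < r by case: hr => ->.
  have [mg [b gb]] := bddP f r r0 Xf; split; first by split => //; exists b.
  split; first exact: measurable_funX.
  exists (b ^+ 2) => x; rewrite normrX lerXn2r ?nnegrE//.
  by rewrite (le_trans _ (gb x)).
- move=> f x Xf; rewrite -lee_fin EFinM -intE//.
  have := tensor_nikolskii hmu linX X0 measX (fun i => powR_ge0 _ _) nikX x Xf.
  by rewrite -powR_prod// => i; rewrite mulr_ge0 ?powR_ge0.
exists m, xi; split => // f Xf; split.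
  by apply: bounded_measurable_integrable; exact: bddP.
by have := hxi f Xf; rewrite /mean card_ord.
Qed.

End product_sampling.

(** * Continuous functions on compact sets and their tensor products *)

Lemma continuous_borel_measurable {R : realType} {T : topologicalType}
    {A : set T} (a : A) (f : A -> R) :
  continuous f -> measurable_fun [set: borel_space a] (f : borel_space a -> R).
Proof.
move=> /continuousP cf.
apply: (@measurability _ _ _ _ _ _ _ (RGenOpens.measurableE R)).
move=> _ [_ [x [y ->]] <-]; rewrite setTI; apply: sub_sigma_algebra.
by apply: cf; exact: interval_open.
Qed.

Lemma nikolskii_powR {R : realType} d (T : measurableType d) (mu : probability T R)
    (f : T -> R) (K q : R) : 0 < q -> 0 <= K ->
  (uniform_norm f <= K%:E * 'N[mu]_(q%:E)[EFin \o f])%E ->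
  forall x, ((`|f x| `^ q)%:E <= (K `^ q)%:E * \int[mu]_y (`|f y| `^ q)%:E)%E.
Proof.
move=> q0 K0 fK x.
have : (`|f x|%:E <= K%:E * 'N[mu]_(q%:E)[EFin \o f])%E.
  by apply: le_trans fK; apply: ereal_sup_ubound; exists x.
move=> /(gt0_ler_poweR (ltW q0)); rewrite !in_itv/= !leey !andbT.
rewrite lee_fin normr_ge0 mule_ge0 ?lee_fin ?Lnorm_ge0// => /(_ erefl erefl).
rewrite poweRM ?lee_fin ?Lnorm_ge0// poweR_Lnorm ?gt_eqF//.
Qed.

Lemma continuous_compact_bounded {R : realType} {T : topologicalType}
    (A : set T) (f : A -> R) :
  compact A -> continuous f -> exists b : R, forall x, `|f x| <= b.
Proof.
move=> cA cf.
pose F := valL_ 0 f.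
have cF : {within A, continuous F}.
  by apply/subspace_sigL_continuousP; rewrite valLK.
have /compact_bounded[M [_ hM]] := continuous_compact cF cA.
exists (M + 1) => x; apply: hM; first by rewrite ltrDl.
exists (set_val x); first exact: set_valP.
by rewrite -[LHS]/(sigL A F x) valLK.
Qed.

Theorem proposition3p3 (R : realType) (p q : R) (hq : 2 <= q) (hqp : q <= p) :
  exists2 C : R, 0 < C &
  forall (s : nat) (hs : (0 < s)%N)
    (d : 'I_s -> nat) (Omega : forall i, set 'rV[R]_(d i))
    (hOmega : forall i, compact (Omega i))
    (o : forall i, Omega i)
    (mu_ : forall i, probability (borel_space (o i)) R)
    (mu : probability (product_space (fun i => borel_space (o i))) R)
    (hmu : is_product_measure mu_ mu)
    (N : 'I_s -> nat) (hN : forall i, (0 < N i)%N)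
    (X : forall i, set (Omega i -> R))
    (hXC : forall i f, X i f -> continuous f)
    (hX : forall i, subspace_of_dim (X i) (N i))
    (B : 'I_s -> R) (hB : forall i, 1 <= B i)
    (hXB : forall i f, X i f ->
       (uniform_norm f <=
        (B i * (N i)%:R `^ q^-1)%:E * 'N[mu_ i]_(q%:E)[EFin \o f])%E),
  exists (m : nat) (xi : 'I_m -> forall i, Omega i),
    [/\ (0 < m)%N,
        m%:R <= C * (\prod_i (B i `^ p * (N i)%:R `^ (p / q))) *
                (log2 (2 * \prod_i (B i * (N i)%:R))) ^+ 3
      & forall f, tensor_space X f ->
        ((2^-1)%:E * 'N[mu]_(p%:E)[EFin \o f] `^ p <=
           (m%:R^-1 * \sum_j `|f (xi j)| `^ p)%:E <=
           (3 / 2)%:E * 'N[mu]_(p%:E)[EFin \o f] `^ p)%E].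
Proof.
have q0 : 0 < q by exact: lt_le_trans hq.
have p0 : 0 < p by exact: lt_le_trans hqp.
have [C C0 sampling] := product_sampling hq hqp.
exists C => // s hs d Omega hOmega o mu_ mu hmu N hN X hXC hX B hB hXB.
have hb i : exists e : 'I_(N i) -> Omega i -> R, X i = lin_span (range e).
  by have [e _ XE] := hX i; exists e.
pose b i := projT1 (cid (hb i)).
have bE i : X i = lin_span (range (b i)) by exact: (projT2 (cid (hb i))).
pose e i (j : nat) : Omega i -> R :=
  if insub j is Some k then b i k else fun=> 0.
have bX i k : X i (b i k) by rewrite bE; apply: lin_span_sub; exists k.
have bounded i f : X i f -> exists M : R, forall x, `|f x| <= M.
  by move=> Xf; exact: continuous_compact_bounded (hOmega i) (hXC i f Xf).
have [|||||||m [xi [m0 mle hxi]]] := sampling s _ (fun i => borel_space (o i))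
    mu_ mu N X e B hmu hN.
- by move=> i; rewrite bE; exact: linear_class_lin_span.
- by move=> i; rewrite bE; exact: lin_span0.
- by move=> i f Xf; apply: continuous_borel_measurable; exact: hXC.
- move=> i j; rewrite /e; case: insubP => [k _ _|_]; first exact: (bounded i).
  by exists 0 => x; rewrite normr0.
- move=> i f Xf; move: (Xf); rewrite {1}bE => /lin_span_range[c cE].
  exists (fun j => if insub j is Some k then c k else 0) => x.
  by rewrite cE; apply: eq_bigr => k _; rewrite /e valK.
- exact: hB.
- move=> i f x Xf.
  have K0 : 0 <= B i * (N i)%:R `^ q^-1.
    by rewrite mulr_ge0 ?powR_ge0// (le_trans _ (hB i)).
  exact: (@nikolskii_powR R _ (borel_space (o i)) (mu_ i) f _ q q0 K0 (hXB i f Xf)).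
exists m, xi; split => // f Xf.
have [int_f /andP[lo hi]] := hxi f Xf.
have -> : ('N[mu]_(p%:E)[EFin \o f] `^ p)%E = (\int[mu]_x (`|f x| `^ p))%:E.
  rewrite poweR_Lnorm ?gt_eqF// /Rintegral fineK; last exact: integrable_fin_num.
  by apply: eq_integral => x _.
by rewrite -!EFinM !lee_fin lo hi.
Qed.
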